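(* Let $G$ be a (possibly infinite) graph and let $T\subseteq V(G)$ be countable such that there is no $X\subseteq V(G)\setminus T$ for which $d_G(X)$ is an odd natural number. Assume that for each $t\in T$ there is a system $\mathcal{P}_t$ of pairwise edge-disjoint $T$-paths in $G$ covering all the edges incident with $t$. Then there exists a system $\mathcal{P}$ of pairwise edge-disjoint $T$-paths in $G$ covering all the edges that are incident with any $t\in T$ (that is, every edge having at least one end-vertex in $T$ lies on a path in $\mathcal{P}$).
   Context: Graphs may be infinite (of any cardinality), may have parallel edges, but have no loops. All paths are finite. Countable means finite or countably infinite. For $X\subseteq V(G)$, $\delta_G(X)$ is the set of edges of $G$ with exactly one end-vertex in $X$, and $d_G(X):=|\delta_G(X)|$ (a possibly infinite cardinal; infinite cardinals are neither odd nor even). A $T$-path is a path connecting two distinct vertices of $T$ and having no internal vertex in $T$. A path-system covers an edge set if each edge of the set is an edge of some path in the system. *)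

(* Defs.v *)
From mathcomp Require Import all_boot.
From mathcomp Require Import boolp classical_sets functions cardinality.
From Stdlib Require List.

Set Implicit Arguments.
Unset Strict Implicit.
Unset Printing Implicit Defensive.

Local Open Scope classical_set_scope.

(* [ends e] is the set of the two end-vertices of [e]; it need not determine
   [e] (parallel edges), and [u <> v] excludes loops. *)
Record multigraph := Multigraph {
  vertex : Type;
  edge : Type;
  ends : edge -> set vertex;
  endsP : forall e, exists u v, u <> v /\ ends e = [set u; v]
}.

Section Multigraph.
Variable G : multigraph.
Implicit Types (X T : set (vertex G)) (e : edge G).

Definition edges_at (v : vertex G) : set (edge G) := [set e | ends e v].

Definition delta X : set (edge G) := [set e | exists! x, ends e x /\ X x].

(* The cardinal d(X) is an odd natural number. *)
Definition odd_degree X : Prop := exists2 n : nat, odd n & (delta X #= `I_n)%card.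

(* The sequence x_0 e_1 x_1 ... e_k x_k is encoded as
   (x_0, [:: (e_1, x_1); ...; (e_k, x_k)]). *)
Definition vewalk : Type := vertex G * seq (edge G * vertex G).

Implicit Types (p : vewalk) (P : set vewalk).

Fixpoint steps_from (x : vertex G) (s : seq (edge G * vertex G)) : Prop :=
  if s is (e, y) :: s' then ends e = [set x; y] /\ steps_from y s' else True.

Definition vertices p : seq (vertex G) := p.1 :: map snd p.2.
Definition first_vertex p : vertex G := p.1.
Definition last_vertex p : vertex G := last p.1 (map snd p.2).
Definition path_edges p : set (edge G) := [set e | List.In e (map fst p.2)].

Definition is_path p : Prop :=
  steps_from p.1 p.2 /\ List.NoDup (vertices p).

Definition internal p : set (vertex G) :=
  [set v | [/\ List.In v (vertices p), v <> first_vertex p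
             & v <> last_vertex p]].

Definition is_T_path T p : Prop :=
  [/\ is_path p, T (first_vertex p), T (last_vertex p),
      first_vertex p <> last_vertex p
    & internal p `&` T = set0].

(* A T-path and its reversal are different encodings of the same path, but as
   they share an edge, at most one of them lies in such a system. *)
Definition T_path_system T P : Prop :=
  (forall p, P p -> is_T_path T p) /\ trivIset P path_edges.

Definition covers P (F : set (edge G)) : Prop :=
  forall e, F e -> exists2 p, P p & path_edges p e.

End Multigraph.

(* Main.v *)
Require Import Defs.
From mathcomp Require Import all_boot finmap.
From mathcomp Require Import boolp classical_sets functions cardinality wochoice.
Set Implicit Arguments.
Unset Strict Implicit.
Unset Printing Implicit Defensive.

(** The hypothesis provides, for each terminal t on its own, a _linking_: one
walk for each edge at t, starting with that edge, ending in another terminal,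
and pairwise edge-disjoint.  The work lies in treating all terminals at once.

The core is [peel_path]: if every terminal has a linking and no set of
non-terminals has odd finite degree, then each edge e at a terminal t lies on a
walk to another terminal, with no terminal inside, whose deletion leaves every
terminal with a linking.  Deleting such a walk also respects the parity
condition, because it crosses each cut of non-terminals an even number of times
([parity_delete]).  So when the edges are countably many, they can be served one
after the other ([countable_packing]).

To find the walk, follow the walk t e v f w ... which a linking of t attaches to
e.  If v is not a terminal, split off: replace e and f by a single edge tw.  The
linking of t survives and the walk gets shorter, so if all other terminals keep
a linking, induction applies.  Suppose that a terminal t' does not.  Then
[split_off] provides a linking of t' and a set Y that contains t' and v but no
other terminal, such that the walks of this linking leave Y, never return,
and use all the edges between Y and its complement.  As e is such an edge, it
ends one of these walks, and this walk from t' to t is the one to delete: any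
walk of another linking that enters Y can be diverted at its first entrance,
going backwards along the walk that leaves Y through the same edge, to end in t'
([linkable_reroute]).

For [split_off], consider how a linking of t' uses e and f.  In most cases its
walks can be cut at v and glued together again along the new edge.  If two walks
get stuck at v, augmenting paths rescue one of them or else what is reachable is
the set Y ([augment_or_barrier]).  If a single walk is stuck at v while one of e
and f is idle, parity decides ([shift_linking]).  Either idle edges lead from v
to a suitable place, or every finite trail of idle edges from v can be prolonged
to meet a walk of the linking not met before, since otherwise the component
of its end has an odd finite cut.  This yields an infinite trail, along which
every walk that is met passes its remainder to the one met before.

It remains to reduce to countably many edges.  Call two edges related if some
given path system contains them in the same path.  As there are countably many
terminals and paths are finite, each edge has countably many relatives.  By
[even_partition_exists] the edges fall into countable classes that are closed
under relatives, hence carry linkings, and which have no odd finite cuts once all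
terminals are identified.  The classes are then treated independently.  This
partition comes from a transfinite induction on generating sets: the edge set is
exhausted by an increasing family of subsets closed under suitable countable
operations, and the differences of consecutive subsets, which have smaller
generating sets, are again without odd cuts ([closure_system]).  The decisive
operations keep together infinite _bundles_ of edge-disjoint walks between two
vertices ([bundle_cover]), so that what remains outside a closed set still
joins infinitely often those vertices of the closed set that it joins at all. *)

(** * Walks and finite odd sets of edges *)

Section Walks.
Variables V E : choiceType.
Implicit Types (g : E -> V * V) (x y z : V) (e f : E) (s : seq (E * V)).
Implicit Types (X : pred V) (S A : pred E).

(** The end function orders the two ends of an edge arbitrarily, and allows
loops, which arise when all terminals are identified. *)
Definition joins g e x y := (g e == (x, y)) || (g e == (y, x)).

Fixpoint walk g x s :=
  if s is (e, y) :: s' then joins g e x y && walk g y s' else true.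

Definition edges s : seq E := unzip1 s.
Definition target x s : V := last x (unzip2 s).
Definition inc g v e := ((g e).1 == v) || ((g e).2 == v).
Definition crosses g X e := X (g e).1 (+) X (g e).2.

(** The reversal of the walk [s] from [x]; it starts at [target x s]. *)
Fixpoint rwalk x s :=
  if s is (e, y) :: s' then rcons (rwalk y s') (e, x) else [::].

Lemma joinsC g e x y : joins g e x y = joins g e y x.
Proof. by rewrite /joins orbC. Qed.

Lemma joins_inj g e x y z : joins g e x y -> joins g e x z -> y = z.
Proof.
by rewrite /joins => /orP[] /eqP-> /orP[] /eqP[] //; [move=> <- <- | move=> <- <-].
Qed.

Lemma joins_cross g e x y X : joins g e x y -> crosses g X e = X x (+) X y.
Proof. by rewrite /crosses => /orP[] /eqP->//=; rewrite addbC. Qed.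

Lemma joins_inc g e x y v : joins g e x y -> inc g v e = (v == x) || (v == y).
Proof.
by rewrite /inc => /orP[] /eqP->/=; rewrite !(eq_sym v)//; rewrite orbC.
Qed.

Lemma joins_refl g e : joins g e (g e).1 (g e).2.
Proof. by rewrite /joins; case: (g e) => a b; rewrite eqxx. Qed.

Lemma walk_cat g x s1 s2 :
  walk g x (s1 ++ s2) = walk g x s1 && walk g (target x s1) s2.
Proof. by elim: s1 x => [|[e y] s1 IH] x //=; rewrite IH andbA. Qed.

Lemma edges_cat s1 s2 : edges (s1 ++ s2) = edges s1 ++ edges s2.
Proof. exact: map_cat. Qed.

Lemma target_cat x s1 s2 : target x (s1 ++ s2) = target (target x s1) s2.
Proof. by rewrite /target /unzip2 map_cat last_cat. Qed.

Lemma target_rcons x s e y : target x (rcons s (e, y)) = y.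
Proof. by rewrite /target /unzip2 map_rcons last_rcons. Qed.

Lemma target_mem x s : s != [::] -> target x s \in unzip2 s.
Proof. by case: s => [|[e y] s] // _; rewrite /target /=; exact: mem_last. Qed.

Lemma walk_rwalk g x s : walk g x s -> walk g (target x s) (rwalk x s).
Proof.
elim: s x => [|[e y] s IH] x //= /andP[exy /IH ws].
rewrite -cats1 walk_cat ws /= andbT.
suff -> : target (target x ((e, y) :: s)) (rwalk y s) = y by rewrite joinsC.
rewrite /target /=; case: s {ws IH} => [|[e' y'] s] //=.
by rewrite /unzip2 map_rcons last_rcons.
Qed.

Lemma target_rwalk x s : target (target x s) (rwalk x s) = x.
Proof. by case: s => [|[e y] s] //=; rewrite target_rcons. Qed.

Lemma edges_rwalk x s : edges (rwalk x s) = rev (edges s).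
Proof.
elim: s x => [|[e y] s IH] x //=.
by have := IH y; rewrite /edges /unzip1 map_rcons rev_cons => ->.
Qed.

Lemma unzip2_rwalk x s : unzip2 (rwalk x s) = rev (belast x (unzip2 s)).
Proof.
elim: s x => [|[e y] s IH] x //=.
by have := IH y; rewrite /unzip2 map_rcons rev_cons => ->.
Qed.

(** Each crossing edge changes the side; hence a walk between terminals crosses a cut
of non-terminals evenly. *)
Lemma odd_crossings g X x s : walk g x s ->
  odd (count (crosses g X) (edges s)) = X x (+) X (target x s).
Proof.
elim: s x => [|[e y] s IH] x /=; first by rewrite addbb.
case/andP=> exy /IH; rewrite oddD (joins_cross _ exy) oddb => ->.
by rewrite -addbA (addbA (X y)) addbb.
Qed.

Lemma mem_split (e : E) s : e \in edges s ->
  exists s1 y s2, s = s1 ++ (e, y) :: s2.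
Proof.
elim: s => [|[f z] s IH] //=; rewrite inE => /orP[/eqP->|/IH[s1 [y [s2 ->]]]].
  by exists [::], z, s.
by exists ((f, z) :: s1), y, s2.
Qed.

Lemma vertex_split x z s : z \in x :: unzip2 s ->
  exists s1 s2, s = s1 ++ s2 /\ target x s1 = z.
Proof.
elim: s x => [|[f y] s IH] x /=; first by rewrite inE => /eqP->; exists [::], [::].
rewrite inE => /orP[/eqP->|/IH[s1 [s2 [-> <-]]]]; first by exists [::], ((f, y) :: s).
by exists ((f, y) :: s1), s2.
Qed.

Lemma walk_ends g x s e y1 : walk g x s -> e \in edges s -> inc g y1 e ->
  y1 \in x :: unzip2 s.
Proof.
elim: s x => [|[f y] s IH] x //= /andP[fxy ws]; rewrite inE => /orP[/eqP->|es].
  by rewrite (joins_inc _ fxy) !inE => /orP[->|->]//; rewrite orbT.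
by move=> /(IH _ ws es); rewrite [in X in _ -> X]inE => ->; rewrite orbT.
Qed.

Lemma walk_uniq_edges g x s :
  walk g x s -> uniq (x :: unzip2 s) -> uniq (edges s).
Proof.
elim: s x => [|[e y] s IH] x //= /andP[exy ws] /and3P[xys ys us].
rewrite (IH y) ?andbT /= ?ys//; apply/negP => es.
have := walk_ends ws es; move/(_ x); rewrite (joins_inc _ exy) eqxx => /(_ isT).
by rewrite (negPf xys).
Qed.

Lemma shorten_walk g x s : walk g x s -> exists s',
  [/\ walk g x s', target x s' = target x s, uniq (x :: unzip2 s')
    & {subset s' <= s}].
Proof.
elim: s x => [|[e y] s IH] x /=; first by exists [::].
case/andP=> exy /IH[s' [ws' ts' us' ss']].
have [/vertex_split[s1 [s2 [def_s' tx]]]|xs'] := boolP (x \in y :: unzip2 s').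
  exists s2; split.
  - by move: ws'; rewrite def_s' walk_cat tx => /andP[].
  - by rewrite /target /= -!/(target _ _) -ts' def_s' target_cat tx.
  - move: us'; rewrite def_s' /unzip2 map_cat -cat_cons cat_uniq.
    case/and3P => _ hx u2; rewrite /= u2 andbT; apply: contra hx => xin.
    by apply/hasP; exists x; rewrite // -tx /target mem_last.
  - by move=> p ps2; rewrite inE ss' ?orbT// def_s' mem_cat ps2 orbT.
exists ((e, y) :: s'); split=> //=; first by rewrite exy.
  by rewrite xs'.
by move=> p; rewrite !inE => /orP[->//|/ss'->]; rewrite orbT.
Qed.

Lemma edges_sub s s' : {subset s' <= s} -> {subset edges s' <= edges s}.
Proof. by move=> ss e /mapP[p /ss ps ->]; apply: map_f. Qed.

(** A set is finite and odd when a duplicate-free list of odd length enumerates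
it; infinite sets are thus neither odd nor even. *)
Definition oddset S : Prop :=
  exists l, [/\ uniq l, forall e, S e = (e \in l) & odd (size l)].

(** Whether a set is finite and odd does not change under a finite modification
of even size: only the list [l] of modified places must be inspected. *)
Lemma oddset_change S S' l : uniq l -> (forall e, e \notin l -> S e = S' e) ->
  odd (count S l) = odd (count S' l) -> oddset S -> oddset S'.
Proof.
move=> ul SS' oSS' [l0 [ul0 Sl0 ol0]].
exists ([seq e <- l0 | e \notin l] ++ [seq e <- l | S' e]); split.
- rewrite cat_uniq !filter_uniq // andbT /=; apply/hasPn => e.
  by rewrite !mem_filter => /andP[_ ->].
- move=> e; rewrite mem_cat !mem_filter -Sl0.
  by have [el|/SS'->] := boolP (e \in l); rewrite /= ?andbT ?andbF ?orbF.
- rewrite size_cat !size_filter oddD -oSS' -oddD.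
  suff -> : count S l = count (mem l) l0.
    by rewrite addnC (_ : count _ l0 + _ = size l0) // -(count_predC (mem l) l0).
  rewrite -!size_filter; apply/perm_size/uniq_perm; rewrite ?filter_uniq//.
  by move=> e; rewrite !mem_filter Sl0 andbC.
Qed.

End Walks.

(** * Linkings of a terminal *)

Section Linkings.
Variables V E : choiceType.
Variable T : pred V.
Implicit Types (g : E -> V * V) (x y z t v w : V) (e f i j k : E).
Implicit Types (s h tl : seq (E * V)) (X : pred V) (A I F : pred E).
Implicit Types (p q : E -> seq (E * V)).

Definition delete A (l : seq E) : pred E := fun e => A e && (e \notin l).
Definition loopless g A := forall e x, A e -> ~~ joins g e x x.
Definition parity g A := forall X, (forall v, X v -> ~~ T v) ->
  ~ oddset (fun e => A e && crosses g X e).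
(** The active edges at a terminal; they index the walks of a linking. *)
Definition star g A t : pred E := fun i => A i && inc g t i.
Definition away t : pred V := fun v => T v && (v != t).
Definition inner_free x s := forall s1 a s2,
  s = s1 ++ a :: s2 -> s1 != [::] -> ~~ T (target x s1).

(** A family of edge-disjoint trails that leave [t], each through the edge that
indexes it.  Nothing is required of their ends, since the constructions below
pass through families in which some trails are stuck at inner vertices. *)
Record bunch g A I t p : Prop := Bunch {
  b_walk : forall i, I i -> walk g t (p i);
  b_head : forall i, I i -> exists y s, p i = (i, y) :: s;
  b_sub : forall i e, I i -> e \in edges (p i) -> A e;
  b_uniq : forall i, I i -> uniq (edges (p i));
  b_disj : forall i j e, I i -> I j -> e \in edges (p i) ->
    e \in edges (p j) -> i = j }.

Definition linking g A t p :=
  bunch g A (star g A t) t p /\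
  forall i, star g A t i -> away t (target t (p i)).
Definition linkable g A t := exists p, linking g A t p.

Definition used I p e := exists2 i, I i & e \in edges (p i).

Lemma walk_congr g g' x s : {in edges s, g =1 g'} -> walk g x s = walk g' x s.
Proof.
elim: s x => [|[e y] s IH] x //= gg; rewrite /joins gg ?inE ?eqxx// IH//.
by move=> f fs; apply: gg; rewrite inE fs orbT.
Qed.

Lemma bunch_self g A I t p i : bunch g A I t p -> I i -> i \in edges (p i).
Proof. by move=> B /(b_head B)[y [s ->]]; rewrite inE eqxx. Qed.

Lemma bunch_weak g g' A A' I I' t p : bunch g A I t p ->
  (forall i, I' i -> I i) ->
  (forall i e, I' i -> e \in edges (p i) -> A' e /\ g e = g' e) ->
  bunch g' A' I' t p.
Proof.
case=> bw bh bs bu bd II AA; split.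
- move=> i Ii; rewrite -(@walk_congr g) ?bw ?II// => e ei.
  by case: (AA i e).
- by move=> i /II/bh.
- by move=> i e Ii /(AA _ _ Ii)[].
- by move=> i /II/bu.
- by move=> i j e /II Ii /II Ij; apply: bd.
Qed.

Definition upd p i s := fun j => if j == i then s else p j.

Lemma bunch_upd g A I t p i s : bunch g A I t p ->
  walk g t s -> (exists y s', s = (i, y) :: s') ->
  {in edges s, forall e, A e} -> uniq (edges s) ->
  (forall e j, I j -> j != i -> e \in edges s -> e \notin edges (p j)) ->
  bunch g A I t (upd p i s).
Proof.
case=> bw bh bs bu bd ws hs As us ds; rewrite /upd; split.
- by move=> j Ij; case: eqP => // _; exact: bw.
- by move=> j Ij; case: eqP => [->//|_]; exact: bh.
- by move=> j e Ij; case: eqP => [_ /As//|_]; exact: bs.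
- by move=> j Ij; case: eqP => // _; exact: bu.
- move=> j k e Ij Ik; case: eqP => [->|/eqP ji]; case: eqP => [->//|/eqP ki].
  + by move=> es ek; have := ds e k Ik ki es; rewrite ek.
  + by move=> ej es; have := ds e j Ij ji es; rewrite ej.
  + exact: bd.
Qed.

(** A trail could come back to [t] only through an edge at [t], but every such edge
is the first edge of its own trail. *)
Lemma no_return g A t p i : loopless g A -> bunch g A (star g A t) t p ->
  star g A t i -> t \notin unzip2 (p i).
Proof.
move=> gA B Ii; apply/negP => tp.
have [s1 [s2 [def_p]]] : exists s1 s2, p i = s1 ++ s2 /\ s1 != [::] /\ target t s1 = t.
  have [y [s def_p]] := b_head B Ii; move: tp; rewrite def_p => /vertex_split.
  by case=> s1 [s2 [-> ts]]; exists ((i, y) :: s1), s2; rewrite /=.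
case/lastP: s1 def_p => [_ []//|s1 [e z] def_p [_]]; rewrite target_rcons => zt.
move: def_p; rewrite zt cat_rcons => def_p {z zt}.
have := b_walk B Ii; rewrite def_p walk_cat /= => /and3P[_ je _].
have ei : e \in edges (p i) by rewrite def_p edges_cat mem_cat inE eqxx orbT.
have Ie : star g A t e.
  by rewrite /star (b_sub B Ii ei) (joins_inc _ je) eqxx orbT.
have def_e := b_disj B Ii Ie ei (bunch_self B Ie); rewrite -{}def_e in ei je def_p.
have [y [s def_p']] := b_head B Ii; have := b_uniq B Ii.
move: je; rewrite def_p; case: s1 def_p => [|[j y'] s1] def_p /=.
  by have /negPf->// : ~~ joins g i t t by apply: gA; case/andP: Ii.
move: def_p; rewrite def_p' => -[<- _ _] _ /andP[].
by rewrite edges_cat mem_cat inE eqxx orbT.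
Qed.

Lemma first_T x s : s != [::] -> T (target x s) -> exists s1 s2,
  [/\ s = s1 ++ s2, s1 != [::], T (target x s1) & inner_free x s1].
Proof.
elim: s x => [|[e y] s IH] x // _ Ts.
have [Ty|Ty] := boolP (T y).
  by exists [:: (e, y)], s; split=> // -[|b s1] a s2 // [_]; case: s1.
case: s IH Ts => [|b s] IH Ts; first by rewrite [T _]Ts in Ty.
have [//|//|s1 [s2 [-> s1n Ts1 is1]]] := IH y.
exists ((e, y) :: s1), s2; split=> // -[|c s3] a s4 // [<- def_s1] _.
have [->//|s3n] := eqVneq s3 [::]; exact: (is1 _ _ _ def_s1).
Qed.

(** Cut each trail at the first terminal that it meets after leaving [t]; by
[no_return] this is not [t] itself. *)
Lemma tame_linking g A t : loopless g A -> linkable g A t ->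
  exists p, linking g A t p /\ forall i, star g A t i -> inner_free t (p i).
Proof.
move=> gA [p [B tB]].
have /choice[q Hq] : forall i, exists s, star g A t i -> exists s2,
    [/\ p i = s ++ s2, s != [::], T (target t s) & inner_free t s].
  move=> i; have [Ii|] := boolP (star g A t i); last by exists [::].
  have [y [s def_p]] := b_head B Ii.
  have [||s1 [s2 H]] := @first_T t (p i); first by rewrite def_p.
    by case/andP: (tB _ Ii).
  by exists s1 => _; exists s2.
have sq i e : star g A t i -> e \in edges (q i) -> e \in edges (p i).
  by move=> /Hq[s2 [-> _ _ _]] eq1; rewrite edges_cat mem_cat eq1.
exists q; split; [split|]; first split.
- by move=> i Ii; have [s2 [def_p _ _ _]] := Hq _ Ii;
    have := b_walk B Ii; rewrite def_p walk_cat => /andP[].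
- move=> i Ii; have [s2 [def_p qn _ _]] := Hq _ Ii.
  have [y [s]] := b_head B Ii; rewrite def_p.
  by case: (q i) qn => //= a s1 _ [-> _]; exists y, s1.
- by move=> i e Ii /(sq _ _ Ii); exact: (b_sub B).
- by move=> i Ii; have [s2 [def_p _ _ _]] := Hq _ Ii;
    have := b_uniq B Ii; rewrite def_p edges_cat cat_uniq => /andP[].
- by move=> i j e Ii Ij /(sq _ _ Ii) ei /(sq _ _ Ij) ej; exact: (b_disj B Ii Ij ei ej).
- move=> i Ii; have [s2 [def_p qn Tq _]] := Hq _ Ii; rewrite /away Tq /=.
  have := no_return gA B Ii; rewrite def_p /unzip2 map_cat mem_cat negb_or.
  by case/andP => tq _; apply: contraNneq tq => <-; exact: target_mem.
- by move=> i Ii; have [s2 []] := Hq _ Ii.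
Qed.

(** A trail between terminals enters a set of non-terminals as often as it leaves
it. *)
Lemma parity_delete g A x s : parity g A -> walk g x s -> T x ->
  T (target x s) -> uniq (edges s) -> {in edges s, forall e, A e} ->
  parity g (delete A (edges s)).
Proof.
move=> gA ws Tx Ty us sA X XT oX; apply: (gA X XT).
have XF z : T z -> X z = false by move=> Tz; apply/negP => /XT; rewrite Tz.
apply: oddset_change us _ _ oX; first by move=> e es; rewrite /delete es andbT.
rewrite (@eq_in_count _ _ pred0 (edges s)); last first.
  by move=> e es; rewrite /delete es andbF.
rewrite count_pred0 (@eq_in_count _ _ (crosses g X) (edges s)); last first.
  by move=> e /sA ->.
by rewrite (odd_crossings X ws) !XF.
Qed.

Lemma parity_delete_paths g A t p (J : seq E) : parity g A -> T t ->
  linking g A t p -> uniq J -> {in J, forall j, star g A t j} ->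
  parity g (fun e => A e && all (fun j => e \notin edges (p j)) J).
Proof.
move=> gA Tt [B tB]; elim: J => [|j J IH] /=.
  by move=> _ _ X XT; apply: contra_not (gA X XT) => -[l [ul le ol]]; exists l;
     split=> // e; rewrite -le andbT.
case/andP => jJ uJ JI; have Ij : star g A t j by apply: JI; rewrite inE eqxx.
have /IH-/(_ uJ) gJ : {in J, forall j, star g A t j}.
  by move=> i iJ; apply: JI; rewrite inE iJ orbT.
have {gJ} := parity_delete gJ (b_walk B Ij) Tt (proj1 (andP (tB _ Ij))) (b_uniq B Ij).
move=> gJ X XT oX; apply: (gJ _ X XT).
  move=> e ej; rewrite (b_sub B Ij ej); apply/allP => i iJ; apply/negP => ei.
  have Ii : star g A t i by apply: JI; rewrite inE iJ orbT.
  by move: jJ; rewrite (b_disj B Ij Ii ej ei) iJ.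
case: oX => l [ul le ol]; exists l; split=> // e; rewrite -le /delete.
by case: (A e) => //=; case: (all _ _); case: (e \notin _).
Qed.

Definition reach g F x z := exists s,
  [/\ walk g x s, {in edges s, forall e, F e} & target x s = z].

Lemma reach_step g F x y z e : reach g F x y -> F e -> joins g e y z ->
  reach g F x z.
Proof.
case=> s [ws Fs ts] Fe je; exists (rcons s (e, z)); split.
- by rewrite -cats1 walk_cat ws ts /= je.
- move=> f; rewrite -cats1 edges_cat mem_cat inE => /orP[/Fs//|/eqP->//].
- exact: target_rcons.
Qed.

Lemma reach_refl g F x : reach g F x x.
Proof. by exists [::]. Qed.

Lemma reach_trans g F x y z : reach g F x y -> reach g F y z -> reach g F x z.
Proof.
case=> s [ws Fs ts] [s' [ws' Fs' ts']]; exists (s ++ s'); split.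
- by rewrite walk_cat ws ts.
- by move=> e; rewrite edges_cat mem_cat => /orP[/Fs|/Fs'].
- by rewrite target_cat ts.
Qed.

Lemma reach_uniq g F x z : reach g F x z -> exists s,
  [/\ walk g x s, {in edges s, forall e, F e}, target x s = z & uniq (edges s)].
Proof.
case=> s [/shorten_walk[s' [ws' ts' us' ss']] Fs <-]; exists s'; split=> //.
  by move=> e /(edges_sub ss')/Fs.
exact: walk_uniq_edges ws' us'.
Qed.

End Linkings.

(** * Shifting a linking along an infinite trail of idle edges *)

(** A linking [p] has a trail [h0 ++ tl0] that is to be cut at the inner vertex [v],
where [h0] ends, and an edge [k] at [v] belongs to no trail.  Idle edges other
than [k] lead from [v] neither to a second terminal nor to the other end [w] of
[k].  The aim is a linking that avoids both [k] and [tl0]. *)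
Section Shift.
Variables V E : choiceType.
Variable T : pred V.
Implicit Types (x y z v w : V) (e f i j : E).
Implicit Types (s h tl : seq (E * V)) (X : pred V).
Variables (g : E -> V * V) (A : pred E) (t : V) (p : E -> seq (E * V)).
Hypotheses (gA : parity T g A) (Lp : linking T g A t p).
Hypothesis Tt : T t.
Variables (i0 : E) (h0 tl0 : seq (E * V)) (k : E) (v w : V).
Hypotheses (I0 : star g A t i0) (def_p0 : p i0 = h0 ++ tl0).
Hypotheses (tgt0 : target t h0 = v) (Tv : ~~ T v).
Hypotheses (Ak : A k) (jk : joins g k v w).
Hypothesis k_free : ~ used (star g A t) p k.

Let I := star g A t.
Definition idle : pred E := fun e => [&& A e, e != k & `[< ~ used I p e >]].

Hypothesis stuck : forall z, reach g idle v z -> ~ (away T t z \/ z = w).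

Let B : bunch g A I t p := proj1 Lp.

Lemma idle_unused e : idle e -> ~ used I p e.
Proof. by case/and3P => _ _ /asboolP. Qed.

Lemma stuck_T z : reach g idle v z -> ~~ T z.
Proof.
move=> rz; have [zt|zt] := eqVneq z t; last first.
  by apply/negP => Tz; case: (stuck rz); left; rewrite /away Tz.
case: rz => s [ws Fs ts]; exfalso; case/lastP: s ws Fs ts => [|s [e y]] ws Fs ts.
  by move: ts Tv; rewrite /target /= => ->; rewrite zt Tt.
move: ts; rewrite target_rcons zt => yt; move: ws Fs; rewrite -cats1 walk_cat yt.
case/andP => _ /= /andP[je _] Fs.
have Fe : idle e by apply: Fs; rewrite edges_cat mem_cat inE eqxx orbT.
apply: (idle_unused Fe); exists e.
  by rewrite /I /star (joins_inc _ je) eqxx orbT; case/andP: Fe => ->.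
by apply: (bunch_self B); rewrite /I /star (joins_inc _ je) eqxx orbT; case/andP: Fe => ->.
Qed.

(** A finite stage of the detour: [trail] is the trail of idle edges walked so far,
[piece] its latest segment; it has just arrived at the vertex where the trail
with index [idx] is cut into [hd] and [tl]; [seen] lists the indices of the
trails met so far. *)
Record state := State {
  seen : seq E; trail : seq (E * V); piece : seq (E * V);
  idx : E; hd : seq (E * V); tl : seq (E * V) }.

Record valid (a : state) : Prop := Valid {
  v_uniq : uniq (seen a);
  v_seen : {in seen a, forall j, I j};
  v_idx : idx a \in seen a;
  v_trail : walk g v (trail a);
  v_utrail : uniq (edges (trail a));
  v_idle : {in edges (trail a), forall e, idle e};
  v_split : p (idx a) = hd a ++ tl a;
  v_hd : hd a != [::];
  v_meet : target v (trail a) = target t (hd a) }.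

Record step (a b : state) : Prop := Step {
  s_trail : trail b = trail a ++ piece b;
  s_seen : seen b = idx b :: seen a;
  s_idx : idx b \notin seen a }.

Lemma valid_start : valid (State [:: i0] [::] [::] i0 h0 tl0).
Proof.
split=> //=; first by move=> j; rewrite inE => /eqP->.
  by rewrite inE.
by apply: contraTneq Tv => h00; rewrite -tgt0 h00 negbK.
Qed.

(** Let C be the component of the end of the trail in the remaining idle edges.  If C
met none of the unseen trails, remove the finitely many seen ones, which keeps
the parity condition: then the edges that leave C are those of the walk which
starts at [w] with [k] and continues along the trail.  It begins outside C and ends
inside, so their number would be odd. *)
Lemma extend_trail a : valid a -> exists b, valid b /\ step a b.
Proof.
case: a => J tau sg i h tl [/= uJ JI iJ wtau utau Ftau def_p hn meet].
set u := target v tau in meet.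
pose F := delete idle (edges tau).
have Fidle z : reach g F u z -> reach g idle v z.
  move=> ruz; apply: (@reach_trans _ _ _ _ _ u); first by exists tau.
  by case: ruz => s [ws Fs ts]; exists s; split=> // e /Fs /andP[].
pose C z := `[< reach g F u z >].
have CT z : C z -> ~~ T z by move=> /asboolP/Fidle/stuck_T.
have [[i' [Ii' i'J [z zp Cz]]]|none] := pselect
    (exists i', [/\ I i', i' \notin J & exists2 z, z \in t :: unzip2 (p i') & C z]).
  have [h' [tl' [def_p' th']]] := vertex_split zp.
  have [s [ws Fs ts us]] := reach_uniq (asboolW Cz).
  exists (State (i' :: J) (tau ++ s) s i' h' tl'); split; last by split.
  split=> //=.
  - by rewrite i'J.
  - by move=> j; rewrite inE => /orP[/eqP->//|/JI].
  - by rewrite inE eqxx.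
  - by rewrite walk_cat wtau.
  - rewrite edges_cat cat_uniq utau us andbT; apply/hasPn => e /Fs /andP[_].
    by [].
  - by move=> e; rewrite edges_cat mem_cat => /orP[/Ftau//|/Fs /andP[]].
  - by apply: contraTneq (CT _ Cz) => h'0; rewrite -th' h'0 negbK.
  - by rewrite target_cat ts th'.
have gA0 := parity_delete_paths gA Tt Lp uJ JI.
case: (gA0 C CT); exists [seq e <- k :: edges tau | crosses g C e].
have kidle e : idle e -> e != k by case/and3P.
split.
- rewrite filter_uniq //= utau andbT.
  by apply/negP => /Ftau/kidle; rewrite eqxx.
- move=> e; rewrite mem_filter andbC; case Ce: (crosses g C e) => //=.
  apply/idP/idP => [/andP[Ae /allP eJ]|]; last first.
    rewrite inE => /orP[/eqP->|/Ftau Fe].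
      rewrite Ak; apply/allP => j /JI Ij; apply/negP => kj; apply: k_free.
      by exists j.
    have [-> _ _] := and3P Fe; apply/allP => j /JI Ij; apply/negP => ej.
    by apply: (idle_unused Fe); exists j.
  have [x [y [je Cx Cy]]] : exists x y, [/\ joins g e x y, C x & ~~ C y].
    move: Ce; rewrite /crosses; case C1: (C _); case C2: (C _) => // _.
      by exists (g e).1, (g e).2; rewrite joins_refl C1 C2.
    by exists (g e).2, (g e).1; rewrite joinsC joins_refl C1 C2.
  have unused : ~ used I p e.
    case=> j Ij ej; apply: none; exists j; split=> //.
      by apply/negP => /eJ; rewrite ej.
    exists x => //; apply: (walk_ends (b_walk B Ij) ej).
    by rewrite (joins_inc _ je) eqxx.
  apply: contraNT Cy; rewrite inE negb_or => /andP[ek etau].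
  apply/asboolP; apply: (reach_step (asboolW Cx) _ je).
  by rewrite /F /delete /idle Ae ek etau /= andbT; apply/asboolP.
- have wk : walk g w ((k, v) :: tau) by rewrite /= joinsC jk.
  rewrite size_filter (odd_crossings C wk) /target /= -/(target v tau) -/u.
  have -> : C u by apply/asboolP/reach_refl.
  suff /negPf-> : ~~ C w by [].
  by apply/negP => /asboolP/Fidle/stuck; apply; right.
Qed.

(** Prolonging the detour forever, let the trail met at stage n go on along the next
segment and take over the remainder of the trail met at stage n + 1.  Then nobody
needs the remainder [tl0] of the first one. *)
Lemma shift_linking : exists q, linking T g A t q /\
  forall i e, I i -> e \in edges (q i) -> e != k /\ e \notin edges tl0.
Proof.
have /choice[nxt nxtP] : forall a, exists b, valid a -> valid b /\ step a b.
  move=> a; have [/extend_trail[b]|na] := pselect (valid a); first by exists b.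
  by exists a.
pose st n := iter n nxt (State [:: i0] [::] [::] i0 h0 tl0).
have va n : valid (st n).
  by elim: n => [|n IH]; [exact: valid_start | case: (nxtP _ IH)].
have stp n : step (st n) (st n.+1) by case: (nxtP _ (va n)).
pose ix n := idx (st n).
have seen_mono m n : m <= n -> {subset seen (st m) <= seen (st n)}.
  move/subnK <-; elim: (n - m) => [//|d IH] e /IH es.
  by rewrite addSn (s_seen (stp _)) inE es orbT.
have ix_lt m n : m < n -> ix m != ix n.
  case: n => // n; rewrite ltnS => mn; apply: contraNneq (s_idx (stp n)) => mn1.
  rewrite (_ : idx _ = ix m) //.
  by apply: (seen_mono _ _ mn); apply: v_idx (va m).
have ix_inj : injective ix.
  move=> m n eq_mn; case: (ltngtP m n) => // /ix_lt; rewrite eq_mn eqxx //.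
have Iix n : I (ix n) by apply: (v_seen (va n)); apply: v_idx (va n).
have trail_mono m n : m <= n -> {subset edges (trail (st m)) <= edges (trail (st n))}.
  move/subnK <-; elim: (n - m) => [//|d IH] e /IH es.
  by rewrite addSn (s_trail (stp _)) edges_cat mem_cat es.
pose Q n := hd (st n) ++ piece (st n.+1) ++ tl (st n.+1).
have /choice[q qP] : forall e, exists s,
    (forall n, ix n = e -> s = Q n) /\ ((forall n, ix n <> e) -> s = p e).
  move=> e; have [[n ne]|non] := pselect (exists n, ix n = e).
    exists (Q n); split=> [m me|/(_ n)//]; congr Q; apply: ix_inj.
    by rewrite ne me.
  by exists (p e); split=> // n ne; case: non; exists n.
have q_ix n : q (ix n) = Q n by case: (qP (ix n)) => H _; exact: H.
have q_old e : (forall n, ix n <> e) -> q e = p e by case: (qP e).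
have hd_p n e : e \in edges (hd (st n)) -> e \in edges (p (ix n)).
  by move=> eh; rewrite (v_split (va n)) edges_cat mem_cat eh.
have tl_p n e : e \in edges (tl (st n)) -> e \in edges (p (ix n)).
  by move=> eh; rewrite (v_split (va n)) edges_cat mem_cat eh orbT.
have hd_tl n e : e \in edges (hd (st n)) -> e \in edges (tl (st n)) -> False.
  move=> eh et; have := b_uniq B (Iix n).
  rewrite (v_split (va n)) edges_cat cat_uniq => /and3P[_ /hasPn/(_ e et)].
  by rewrite /= eh.
have pc_tr n e : e \in edges (piece (st n.+1)) -> e \in edges (trail (st n.+1)).
  by move=> ep; rewrite (s_trail (stp n)) edges_cat mem_cat ep orbT.
have pc_idle n e : e \in edges (piece (st n.+1)) -> idle e.
  by move=> /pc_tr /(v_idle (va n.+1)).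
have pc_unused n i e : e \in edges (piece (st n.+1)) -> I i ->
    e \in edges (p i) -> False.
  by move=> /pc_idle/idle_unused + Ii ei; apply; exists i.
have tr_pc n e : e \in edges (trail (st n)) -> e \in edges (piece (st n.+1)) -> False.
  move=> et ep; have := v_utrail (va n.+1).
  rewrite (s_trail (stp n)) edges_cat cat_uniq => /and3P[_ /hasPn/(_ e ep)].
  by rewrite /= et.
have pc_inj m n e : e \in edges (piece (st m.+1)) ->
    e \in edges (piece (st n.+1)) -> m = n.
  move=> em en; case: (ltngtP m n) => // lt; exfalso.
    exact: (tr_pc n e (trail_mono _ _ lt _ (pc_tr _ _ em)) en).
  exact: (tr_pc m e (trail_mono _ _ lt _ (pc_tr _ _ en)) em).
have Qcase n e : e \in edges (Q n) -> [\/ e \in edges (hd (st n)),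
    e \in edges (piece (st n.+1)) | e \in edges (tl (st n.+1))].
  rewrite /Q !edges_cat !mem_cat => /or3P[]; by [constructor 1|constructor 2|constructor 3].
have p_inj := b_disj B.
have Q_old n i e : I i -> (forall m, ix m <> i) -> e \in edges (Q n) ->
    e \in edges (p i) -> False.
  move=> Ii ni /Qcase[/hd_p eh ei|/pc_unused H /(H _ Ii)//|/tl_p eh ei].
    exact: (ni n (p_inj _ _ _ (Iix n) Ii eh ei)).
  exact: (ni n.+1 (p_inj _ _ _ (Iix n.+1) Ii eh ei)).
have hh m n e : e \in edges (p (ix m)) -> e \in edges (p (ix n)) -> m = n.
  by move=> em en; apply: ix_inj; apply: (p_inj _ _ e).
have QQ m n e : e \in edges (Q m) -> e \in edges (Q n) -> m = n.
  move=> /Qcase[a|a|a] /Qcase[b|b|b].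
  - exact: (hh _ _ _ (hd_p _ _ a) (hd_p _ _ b)).
  - by case: (pc_unused _ _ _ b (Iix m) (hd_p _ _ a)).
  - have mn := hh _ _ _ (hd_p _ _ a) (tl_p _ _ b).
    by case: (@hd_tl m e a); rewrite mn.
  - by case: (pc_unused _ _ _ a (Iix n) (hd_p _ _ b)).
  - exact: (pc_inj _ _ _ a b).
  - by case: (pc_unused _ _ _ a (Iix n.+1) (tl_p _ _ b)).
  - have mn := hh _ _ _ (hd_p _ _ b) (tl_p _ _ a).
    by case: (@hd_tl n e b); rewrite mn.
  - by case: (pc_unused _ _ _ b (Iix m.+1) (tl_p _ _ a)).
  - by have [] := hh _ _ _ (tl_p _ _ a) (tl_p _ _ b).
have split_walk n := b_walk B (Iix n).
have ix_or i : (exists n, i = ix n) \/ (forall n, ix n <> i).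
  by have [[n ni]|no] := pselect (exists n, i = ix n); 
     [left; exists n|right=> n ni; apply: no; exists n].
have Qtgt n : target t (Q n) = target t (p (ix n.+1)).
  rewrite /Q !target_cat -(v_meet (va n)) -(target_cat v) -(s_trail (stp n)).
  by rewrite (v_meet (va n.+1)) (v_split (va n.+1)) target_cat.
exists q; split; [split; first split|].
- move=> i Ii; have [[n ->]|/q_old->] := ix_or i; last exact: (b_walk B Ii).
  rewrite q_ix /Q !walk_cat -(v_meet (va n)) -(target_cat v) -(s_trail (stp n)).
  have := split_walk n; rewrite (v_split (va n)) walk_cat => /andP[-> _] /=.
  have := v_trail (va n.+1); rewrite {1}(s_trail (stp n)) walk_cat => /andP[_ ->] /=.
  have := split_walk n.+1; rewrite (v_split (va n.+1)) walk_cat => /andP[_].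
  by rewrite (v_meet (va n.+1)).
- move=> i Ii; have [[n ->]|/q_old->] := ix_or i; last exact: (b_head B Ii).
  have [y [s]] := b_head B (Iix n); rewrite q_ix /Q (v_split (va n)).
  case: (hd _) (v_hd (va n)) => //= a s' _ [-> _]; by eexists; eexists.
- move=> i e Ii; have [[n ->]|/q_old->] := ix_or i; last exact: (b_sub B Ii).
  rewrite q_ix => /Qcase[/hd_p|/pc_idle/and3P[]//|/tl_p]; exact: (b_sub B).
- move=> i Ii; have [[n ->]|/q_old->] := ix_or i; last exact: (b_uniq B Ii).
  rewrite q_ix /Q !edges_cat.
  have := b_uniq B (Iix n); rewrite (v_split (va n)) edges_cat cat_uniq => /andP[uh _].
  have := b_uniq B (Iix n.+1); rewrite (v_split (va n.+1)) edges_cat cat_uniq => /and3P[_ _ ut].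
  have := v_utrail (va n.+1); rewrite (s_trail (stp n)) edges_cat cat_uniq => /and3P[_ _ up].
  rewrite cat_uniq uh cat_uniq up ut /= !andbT; apply/andP; split; apply/hasPn => e.
    rewrite mem_cat => /orP[eP|eT]; apply/negP => eH.
      exact: (pc_unused n _ _ eP (Iix n) (hd_p n _ eH)).
    by have := hh n n.+1 _ (hd_p n _ eH) (tl_p n.+1 _ eT); exact: n_Sn.
  by move=> eT; apply/negP => eP; exact: (pc_unused n _ _ eP (Iix n.+1) (tl_p n.+1 _ eT)).
- move=> i j e Ii Ij; have [[m ->]|ni] := ix_or i; have [[n ->]|nj] := ix_or j.
  + by rewrite !q_ix => em /(QQ _ _ _ em) ->.
  + by rewrite q_ix (q_old j nj) => em /(Q_old _ _ _ Ij nj em).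
  + by rewrite q_ix (q_old i ni) => em en; case: (Q_old _ _ _ Ii ni en em).
  + by rewrite (q_old i ni) (q_old j nj); exact: p_inj.
- move=> i Ii; have [[n ->]|/q_old->] := ix_or i; last exact: (proj2 Lp).
  by rewrite q_ix Qtgt; exact: (proj2 Lp).
- move=> i e Ii eq_i; split.
    apply/eqP => ek; move: eq_i; rewrite {}ek.
    have [[n ->]|/q_old->] := ix_or i; last by move=> ki; apply: k_free; exists i.
    rewrite q_ix => /Qcase[/hd_p kk|/pc_idle/and3P[_]|/tl_p kk].
    + by apply: k_free; exists (ix n).
    + by rewrite eqxx.
    + by apply: k_free; exists (ix n.+1).
  apply/negP => etl.
  have e0 : e \in edges (p (ix 0)) by apply: tl_p.
  move: eq_i; have [[n ->]|ni] := ix_or i.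
    rewrite q_ix => /Qcase[eh|/pc_unused H|et].
    + have n0 := hh _ _ _ (hd_p _ _ eh) e0; rewrite n0 in eh.
      exact: (@hd_tl 0 e eh).
    + exact: H (Iix 0) e0.
    + by have := hh _ _ _ (tl_p _ _ et) e0.
  by rewrite (q_old _ ni) => ei; apply: (ni 0); exact: (p_inj _ _ e (Iix 0) Ii).
Qed.

End Shift.

(** * Augmenting a linking with two stuck paths *)

Section Augment.
Variables V E : choiceType.
Variable T : pred V.
Implicit Types (g : E -> V * V) (x y z t v w u : V) (e f i j k a b c : E).
Implicit Types (s h tl : seq (E * V)) (X Y : pred V) (A I F : pred E).
Implicit Types (p q : E -> seq (E * V)).

Lemma joins_pair g e x y z w : joins g e x y -> joins g e z w ->
  (x = z /\ y = w) \/ (x = w /\ y = z).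
Proof. by rewrite /joins => /orP[]/eqP-> /orP[]/eqP[-> ->]; [left|right|right|left]. Qed.

Lemma split_uniq s1 s2 s1' s2' e x x' : uniq (edges (s1 ++ (e, x) :: s2)) ->
  s1 ++ (e, x) :: s2 = s1' ++ (e, x') :: s2' -> [/\ s1 = s1', x = x' & s2 = s2'].
Proof.
elim: s1 s1' => [|[c z] s1 IH] [|[c' z'] s1'] /=.
- by move=> _ [-> ->].
- move=> /andP[es2 _] [ec _ def_s2]; move: es2; rewrite def_s2 -ec edges_cat.
  by rewrite mem_cat inE eqxx orbT.
- move=> /andP[cs _] [ce _ _]; move: cs; rewrite ce edges_cat mem_cat inE eqxx.
  by rewrite orbT.
- by move=> /andP[_ us] [-> -> /(IH _ us)[-> -> ->]].
Qed.

Lemma mem_edges s e x : (e, x) \in s -> e \in edges s.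
Proof. exact: (map_f fst). Qed.

Lemma upd_same p i s : upd p i s i = s.
Proof. by rewrite /upd eqxx. Qed.

Lemma upd_other p i s j : j != i -> upd p i s j = p j.
Proof. by rewrite /upd => /negPf->. Qed.

Lemma bunch_prefix g A I t p i h tl : bunch g A I t p -> I i ->
  p i = h ++ tl -> h != [::] -> bunch g A I t (upd p i h).
Proof.
move=> B Ii def_p hn; apply: (bunch_upd B).
- by have := b_walk B Ii; rewrite def_p walk_cat => /andP[].
- have [y [s]] := b_head B Ii; rewrite def_p.
  by case: h hn {def_p} => // d h _ [-> _]; exists y, h.
- by move=> e eh; apply: (b_sub B Ii); rewrite def_p edges_cat mem_cat eh.
- by have := b_uniq B Ii; rewrite def_p edges_cat cat_uniq => /andP[].
- move=> e j Ij ji eh; apply: contra ji => ej; apply/eqP.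
  by apply: (b_disj B Ij Ii ej); rewrite def_p edges_cat mem_cat eh.
Qed.

Lemma bunch_append g A I t p i s : bunch g A I t p -> I i ->
  walk g (target t (p i)) s -> {in edges s, forall e, A e} ->
  uniq (edges s) -> {in edges s, forall e, ~ used I p e} ->
  bunch g A I t (upd p i (p i ++ s)).
Proof.
move=> B Ii ws As us ns; apply: (bunch_upd B).
- by rewrite walk_cat (b_walk B Ii).
- by have [y [s' ->]] := b_head B Ii; exists y, (s' ++ s).
- by move=> e; rewrite edges_cat mem_cat => /orP[/(b_sub B Ii)|/As].
- rewrite edges_cat cat_uniq (b_uniq B Ii) us andbT; apply/hasPn => e es.
  by apply/negP => ei; apply: (ns e es); exists i.
- move=> e j Ij ji; rewrite edges_cat mem_cat => /orP[ei|es]; apply/negP => ej.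
    by move: ji; rewrite (b_disj B Ij Ii ej ei) eqxx.
  by apply: (ns e es); exists j.
Qed.

(** A trail that arrives at a vertex of another one may take over its remainder. *)
Lemma bunch_swap g A I t p a i h d tl : bunch g A I t p -> I a -> I i -> a != i ->
  p i = h ++ d :: tl -> h != [::] -> target t (p a) = d.2 ->
  bunch g A I t (upd (upd p i h) a (p a ++ tl)).
Proof.
case: d => c x B Ia Ii ai def_p hn /= tx.
have Bp := bunch_prefix B Ii def_p hn.
have := @bunch_append _ _ _ _ _ a tl Bp Ia; rewrite (upd_other _ _ ai); apply.
- by have := b_walk B Ii; rewrite def_p walk_cat tx /= => /and3P[].
- move=> e et; apply: (b_sub B Ii).
  by rewrite def_p edges_cat mem_cat inE et !orbT.
- by have := b_uniq B Ii; rewrite def_p edges_cat cat_uniq /= => /and4P[].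
move=> e et; case=> j Ij.
have ei : e \in edges (p i) by rewrite def_p edges_cat mem_cat inE et !orbT.
rewrite /upd; case: eqP => [_ eh|ji /(b_disj B Ii Ij ei) ij]; last by rewrite ij in ji.
have := b_uniq B Ii; rewrite def_p edges_cat cat_uniq => /and3P[_ /hasPn/(_ e) H _].
by move: H; rewrite inE et orbT /= eh => /(_ isT).
Qed.

(** All trails reach another terminal except those of [a] and [b], which are stuck
at [x] and [y].  The two indices may change during augmentation, as trails exchange
remainders; the pair of stuck ends is what is controlled. *)
Record two_ends g A I t (x y : V) a b q : Prop := TwoEnds {
  te_bunch : bunch g A I t q;
  te_a : I a; te_b : I b; te_ab : a != b;
  te_x : target t (q a) = x;
  te_y : target t (q b) = y;
  te_away : forall i, I i -> i != a -> i != b -> away T t (target t (q i)) }.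

(** Push the end stuck at [u] along the residual walk [s], that is, a walk none of
whose steps is taken in the same direction by the trails.  A step along an idle
edge prolongs the stuck trail.  If the edge is taken in the opposite direction by
some trail, the stuck trail takes over its remainder, and that trail gets stuck one
step further.  As the edges of [s] are distinct, its later steps remain residual. *)
Lemma augment g A I t u y a b q s : two_ends g A I t u y a b q ->
  walk g u s -> uniq (edges s) -> {in edges s, forall e, A e} ->
  t \notin unzip2 s -> (forall d i, d \in s -> I i -> d \notin q i) ->
  exists a' b' q', two_ends g A I t (target u s) y a' b' q'.
Proof.
elim: s u a b q => [|[c x] s IH] u a b q W; first by exists a, b, q.
have [B Ia Ib ab tu ty ta] := W.
rewrite /= inE negb_or => /andP[jc ws] /andP[cs us] As /andP[tx ts] fr.
have {}As : A c /\ {in edges s, forall e, A e}.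
  by split=> [|e es]; apply: As; rewrite inE ?eqxx ?es ?orbT.
suff [a' [b' [q' [W' sub]]]] : exists a' b' q', two_ends g A I t x y a' b' q' /\
    forall d i, I i -> d \in q' i -> d = (c, x) \/ exists2 j, I j & d \in q j.
  apply: (IH _ _ _ _ W') => //; first by case: As.
  move=> d i ds Ii; apply/negP => /(sub _ _ Ii)[dc|[j Ij dj]].
    by move: cs; rewrite (@mem_edges s c x) // -dc.
  by have := fr d j; rewrite inE ds orbT dj => /(_ isT Ij).
have [[i Ii ci]|nc] := pselect (used I q c); last first.
  exists a, b, (upd q a (q a ++ [:: (c, x)])); split; last first.
    move=> d i Ii; rewrite /upd; case: eqP => [_|_]; last by right; exists i.
    by rewrite mem_cat inE => /orP[da|/eqP->]; [right; exists a|left].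
  split=> //.
  - apply: bunch_append => //=; first by rewrite tu jc.
      by move=> e; rewrite inE => /eqP->; case: As.
    by move=> e; rewrite inE => /eqP->.
  - by rewrite upd_same target_cat.
  - by rewrite upd_other // eq_sym.
  - by move=> i Ii ia ib; rewrite upd_other // ta.
have [h [z [tl def_q]]] := mem_split ci.
have wq := b_walk B Ii; move: wq; rewrite def_q walk_cat /= => /and3P[wh jz wtl].
have [[hx zu]|[hu zx]] := joins_pair jz (etrans (joinsC _ _ _ _) jc); last first.
  by have := fr (c, x) i; rewrite inE eqxx def_q mem_cat inE zx eqxx orbT => /(_ isT Ii).
have hn : h != [::] by apply: contra_neq tx => h0; rewrite -hx h0.
have dq d : d \in h ++ tl -> d \in q i.
  by rewrite def_q !mem_cat inE => /orP[->//|->]; rewrite !orbT.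
have [ia|ia] := eqVneq i a.
  exists a, b, (upd q a h); split; last first.
    move=> d j Ij; rewrite /upd; case: eqP => [_ dh|_]; last by right; exists j.
    by right; exists i => //; apply: dq; rewrite mem_cat dh.
  split=> //.
  - by rewrite -ia; apply: (bunch_prefix B Ii def_q hn).
  - by rewrite upd_same.
  - by rewrite upd_other // eq_sym.
  - by move=> j Ij ja jb; rewrite upd_other // ta.
have B' : bunch g A I t (upd (upd q i h) a (q a ++ tl)).
  by apply: (bunch_swap B Ia Ii _ def_q hn); rewrite 1?eq_sym //= tu zu.
have sub d j : I j -> d \in upd (upd q i h) a (q a ++ tl) j ->
    d = (c, x) \/ exists2 j, I j & d \in q j.
  move=> Ij; right; move: H; rewrite /upd; case: eqP => [_|_].
    rewrite mem_cat => /orP[da|dt]; first by exists a.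
    by exists i => //; apply: dq; rewrite mem_cat dt orbT.
  case: eqP => [_ dh|_ dj]; last by exists j.
  by exists i => //; apply: dq; rewrite mem_cat dh.
have tgt_a : target t (upd (upd q i h) a (q a ++ tl) a) = target t (q i).
  by rewrite upd_same target_cat tu -zu def_q target_cat.
have tgt_i : target t (upd (upd q i h) a (q a ++ tl) i) = x.
  by rewrite upd_other // upd_same.
have [ib|ib] := eqVneq i b.
  exists b, a, (upd (upd q i h) a (q a ++ tl)); split=> //; split=> //.
  - by rewrite eq_sym.
  - by rewrite -ib.
  - by rewrite tgt_a ib.
  - by move=> j Ij jb ja; rewrite !upd_other ?ib // ta.
exists i, b, (upd (upd q i h) a (q a ++ tl)); split=> //; split=> //.
- by rewrite !upd_other // eq_sym.
- move=> j Ij ji jb; have [->|ja] := eqVneq j a; first by rewrite tgt_a ta.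
  by rewrite !upd_other // ta.
Qed.

(** The trails of [p] leave [Y] at most once, as they never enter it, and exhaust the
edges between [Y] and its complement: a cut that every linking of [t] has to
saturate when the degrees are finite. *)
Record barrier g A t p Y : Prop := Barrier {
  ba_T : forall z, T z -> Y z = (z == t);
  ba_out : forall i s1 c x s2, star g A t i -> p i = s1 ++ (c, x) :: s2 ->
    ~~ Y (target t s1) -> ~~ Y x;
  ba_cover : forall c, A c -> crosses g Y c -> used (star g A t) p c }.

(** Two trails pass through [v], one going on along [e] to the terminal [te], the
other along [f].  Cut both at [v] and search for residual walks from [v] that avoid
[e] and [f].  If one reaches a terminal other than [t], augmenting along it rescues
one of the two trails and the other goes on along [e], so that [f] becomes idle.
Otherwise the vertices reached, together with [t], form a barrier. *)
Lemma augment_or_barrier g A t p i1 i2 h1 h2 e f te v w tl2 :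
  loopless g A -> linking T g A t p -> T t ->
  star g A t i1 -> star g A t i2 -> i1 != i2 ->
  p i1 = h1 ++ [:: (e, te)] -> target t h1 = v -> ~~ T v ->
  p i2 = h2 ++ (f, w) :: tl2 -> target t h2 = v ->
  (exists Y, barrier g A t p Y /\ Y v) \/
  (exists q, linking T g A t q /\ ~ used (star g A t) q f /\
     exists i h, [/\ star g A t i, q i = h ++ [:: (e, te)] & target t h = v]).
Proof.
move=> gA [B tB] Tt I1 I2 i12 def_p1 th1 Tv def_p2 th2.
have vt : v != t by apply: contraNneq Tv => ->.
have h1n : h1 != [::] by apply: contra_neq vt => h10; rewrite -th1 h10.
have h2n : h2 != [::] by apply: contra_neq vt => h20; rewrite -th2 h20.
have e1 : e \in edges (p i1) by rewrite def_p1 edges_cat mem_cat inE eqxx orbT.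
have f2 : f \in edges (p i2) by rewrite def_p2 edges_cat mem_cat inE eqxx orbT.
pose I := star g A t; pose A' := delete A [:: e; f].
pose q0 := upd (upd p i1 h1) i2 h2.
have q0p d i : d \in q0 i -> d \in p i.
  rewrite /q0 /upd; case: eqP => [->|_].
    by rewrite def_p2 mem_cat => ->.
  by case: eqP => [->|//]; rewrite def_p1 mem_cat => ->.
have B0 : bunch g A' I t q0.
  have Bq : bunch g A I t q0.
    apply: (bunch_prefix (bunch_prefix B I1 def_p1 h1n) I2 _ h2n).
    by rewrite upd_other ?def_p2 // eq_sym.
  apply: (bunch_weak Bq) => // i c Ii ci; split=> //.
  rewrite /A' /delete (b_sub Bq Ii ci) !inE negb_or /=.
  have ci' : c \in edges (p i) by case/mapP: ci => d /q0p dp ->; exact: map_f.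
  apply/andP; split; apply/eqP => cE; move: ci ci'; rewrite {}cE => ci ci'.
    have i_1 := b_disj B Ii I1 ci' e1; move: ci; rewrite i_1 /q0 upd_other // upd_same.
    move=> eh; have := b_uniq B I1; rewrite def_p1 edges_cat cat_uniq /= orbF.
    by rewrite eh /= andbF.
  have i_2 := b_disj B Ii I2 ci' f2; move: ci; rewrite i_2 /q0 upd_same => eh.
  have := b_uniq B I2; rewrite def_p2 edges_cat cat_uniq /=.
  by rewrite eh /= andbF.
have W0 : two_ends g A' I t v v i1 i2 q0.
  split=> //; rewrite /q0.
  - by rewrite upd_other // upd_same.
  - by rewrite upd_same.
  - by move=> i Ii ni1 ni2; rewrite !upd_other // tB.
pose rr z := exists s, [/\ walk g v s, {in edges s, forall c, A' c},
  t \notin unzip2 s, (forall d i, d \in s -> I i -> d \notin q0 i) & target v s = z].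
have [[z [rz Tz]]|no] := pselect (exists z, rr z /\ away T t z).
  right; case: rz => s [/shorten_walk[s' [ws' ts' us' ss']] As nts fr tz].
  have [|||a [b [q W]]] := augment W0 ws' (walk_uniq_edges ws' us').
  - by move=> c /(edges_sub ss')/As.
  - apply: contra nts => /mapP[d /ss' ds ->]; exact: map_f.
  - by move=> d i /ss'; exact: fr.
  rewrite ts' tz in W; have [Bq Ia Ib ab tx ty ta] := W.
  have Bq' : bunch g A I t q.
    by apply: (bunch_weak Bq) => // i c Ii /(b_sub Bq Ii)/andP[].
  have je : joins g e v te.
    by have := b_walk B I1; rewrite def_p1 walk_cat th1 /= andbT => /andP[].
  have n_e c : used I q c -> c != e /\ c != f.
    by case=> i Ii /(b_sub Bq Ii)/andP[_]; rewrite !inE negb_or => /andP[].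
  exists (upd q b (q b ++ [:: (e, te)])); split; [split|split].
  - apply: bunch_append; rewrite //= ?ty ?je // => c; rewrite inE => /eqP->.
      exact: (b_sub B I1 e1).
    by move=> /n_e[]; rewrite eqxx.
  - move=> i Ii; have [->|ib] := eqVneq i b.
      rewrite upd_same target_cat.
      by have := tB _ I1; rewrite def_p1 target_cat.
    rewrite upd_other //; have [->|ia] := eqVneq i a; first by rewrite tx.
    exact: ta.
  - case=> i Ii; rewrite /upd; case: eqP => [_|_]; last first.
      by move=> fi; have [] := n_e f; [exists i|rewrite eqxx].
    rewrite edges_cat mem_cat inE => /orP[fi|/eqP fe].
      by have [] := n_e f; [exists b|rewrite eqxx].
    by move: f2; rewrite fe => e2; move: i12; rewrite (b_disj B I1 I2 e1 e2) eqxx.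
  - by exists b, (q b); rewrite upd_same.
left; pose Y z := `[< rr z >] || (z == t); exists Y.
have rrv : rr v by exists [::].
(* An edge leaving [Y] is used outwards by the cut trails, for otherwise its outer
   end could be reached; edges at [t] are used by the trails they index. *)
have clos u x c : Y u -> A' c -> joins g c u x -> ~~ Y x ->
    exists2 i, I i & (c, x) \in q0 i.
  move=> Yu Ac jc; rewrite /Y negb_or => /andP[/asboolPn nr xt].
  have [[d [Id]]|nd] := pselect (exists i, I i /\ (c, x) \in q0 i); first by exists d.
  case/orP: Yu => [/asboolP[s [ws As nts fr ts]]|/eqP ut].
    case: nr; exists (rcons s (c, x)); split.
    - by rewrite -cats1 walk_cat ws ts /= jc.
    - move=> b; rewrite -cats1 edges_cat mem_cat inE => /orP[/As//|/eqP->//].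
    - by rewrite /unzip2 map_rcons mem_rcons inE negb_or eq_sym xt.
    - move=> b i; rewrite mem_rcons inE => /orP[/eqP-> Ii|]; last exact: fr.
      by apply/negP => bi; apply: nd; exists i.
    - exact: target_rcons.
  have Ic : I c by rewrite /I /star (joins_inc _ jc) ut eqxx; case/andP: Ac => ->.
  have [y [s def_c]] := b_head B0 Ic; exists c => //.
  have := b_walk B0 Ic; rewrite def_c /= -ut => /andP[/(joins_inj jc)-> _].
  by rewrite inE eqxx.
have AA' c : A c -> c != e -> c != f -> A' c.
  by move=> Ac ce cf; rewrite /A' /delete Ac !inE negb_or ce cf.
have Yv : Y v by apply/orP; left; exact/asboolP.
split=> //; split.
- move=> z Tz; rewrite /Y; case: (eqVneq z t) => [//|zt]; rewrite ?orbT ?orbF //.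
  by apply/negP => /asboolP rz; apply: no; exists z; rewrite /away Tz.
- move=> i s1 c x s2 Ii def_p; apply: contra => Yx.
  have cp : c \in edges (p i) by rewrite def_p edges_cat mem_cat inE eqxx orbT.
  have ui := b_uniq B Ii.
  have [ce|ce] := eqVneq c e.
    rewrite ce in cp def_p; have i_1 := b_disj B Ii I1 cp e1.
    rewrite {}i_1 in ui def_p; rewrite def_p in ui def_p1.
    by have [-> _ _] := split_uniq ui def_p1; rewrite th1.
  have [cf|cf] := eqVneq c f.
    rewrite cf in cp def_p; have i_2 := b_disj B Ii I2 cp f2.
    rewrite {}i_2 in ui def_p; rewrite def_p in ui def_p2.
    by have [-> _ _] := split_uniq ui def_p2; rewrite th2.
  apply/negPn/negP => Ys.
  have jc : joins g c x (target t s1).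
    by have := b_walk B Ii; rewrite def_p walk_cat joinsC /= => /and3P[].
  have Ac := b_sub B Ii cp.
  have [j Ij /q0p cj] := clos _ _ _ Yx (AA' _ Ac ce cf) jc Ys.
  have ij := b_disj B Ii Ij cp (mem_edges cj); rewrite -{}ij in cj.
  have [s1' [s2' def_p']] : exists s1' s2', p i = s1' ++ (c, target t s1) :: s2'.
    by case/splitPr: cj => s1' s2'; exists s1', s2'.
  move: ui; rewrite def_p => ui; rewrite def_p in def_p'.
  have [_ xx _] := split_uniq ui def_p'.
  by move: jc; rewrite -xx; apply/negP; exact: gA.
- move=> c Ac cY.
  have [->|ce] := eqVneq c e; first by exists i1.
  have [->|cf] := eqVneq c f; first by exists i2.
  have [x [y [jc Yx Yy]]] : exists x y, [/\ joins g c x y, Y x & ~~ Y y].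
    move: cY; rewrite /crosses; case C1: (Y _); case C2: (Y _) => // _.
      by exists (g c).1, (g c).2; rewrite joins_refl C1 C2.
    by exists (g c).2, (g c).1; rewrite joinsC joins_refl C1 C2.
  have [j Ij /q0p/mem_edges cj] := clos _ _ _ Yx (AA' _ Ac ce cf) jc Yy.
  by exists j.
Qed.

End Augment.

(** * Splitting off two edges at a vertex *)

Section Split.
Variables V E : choiceType.
Variable T : pred V.
Implicit Types (x y z t v w u : V) (e f i j k a b c : E).
Implicit Types (s h tl : seq (E * V)) (X Y : pred V) (I : pred E).
Implicit Types (p q : E -> seq (E * V)).

(** Splitting off [e] = [te v] and [f] = [v w] is encoded by giving [e] the new ends
[te] and [w] and by deleting [f]. *)
Definition reattach (g : E -> V * V) e x y : E -> V * V :=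
  fun c => if c == e then (x, y) else g c.

Lemma delete_sub (A : pred E) (l l' : seq E) e : {subset l' <= l} ->
  delete A l e -> delete A l' e.
Proof. by move=> ll /andP[Ae el]; rewrite /delete Ae; apply: contra el; exact: ll. Qed.

Variables (g : E -> V * V) (A : pred E) (t : V).
Hypotheses (gA : parity T g A) (lA : loopless g A) (Tt : T t).
Variables (e f : E) (te v w : V).
Hypotheses (Te : T te) (Tv : ~~ T v) (tet : te != t).
Hypotheses (Ae : A e) (Af : A f) (ef : e != f).
Hypotheses (je : joins g e te v) (jf : joins g f v w).

Let g' := reattach g e te w.
Let A' := delete A [:: f].
Let A2 := delete A [:: e; f].
Let I := star g A t.

Let vt : v != t. Proof. by apply: contraNneq Tv => ->. Qed.
Let te_away : away T t te. Proof. by rewrite /away Te. Qed.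
Let g'e : joins g' e w te.
Proof. by rewrite /joins /g' /reattach !eqxx orbT. Qed.
Let A'e : A' e. Proof. by rewrite /A' /delete Ae inE. Qed.
Let Ie : ~~ I e.
Proof.
by rewrite /I /star (joins_inc _ je) (eq_sym t te) (eq_sym t v) (negPf tet) (negPf vt) andbF.
Qed.

Lemma bunch_reattach J q : bunch g A2 J t q -> bunch g' A' J t q.
Proof.
move=> B; apply: (bunch_weak B) => // i c Ji ci.
have := b_sub B Ji ci => /andP[Ac]; rewrite !inE negb_or => /andP[ce cf].
by rewrite /A' /delete Ac inE cf /g' /reattach (negPf ce).
Qed.

Lemma star_reattach i : w != t -> star g' A' t i -> I i.
Proof.
move=> wt /andP[/andP[Ai _]]; rewrite /I /star Ai /g' /inc /reattach /=.
by case: (i == e); rewrite //= (negPf tet) (negPf wt).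
Qed.

Lemma linkable_avoid q : w != t -> bunch g A2 I t q ->
  (forall i, I i -> away T t (target t (q i))) -> linkable T g' A' t.
Proof.
move=> wt /bunch_reattach B tq; exists q; split; last first.
  by move=> i /(star_reattach wt); exact: tq.
apply: (bunch_weak B) => [i|i c]; first exact: star_reattach.
by move=> /(star_reattach wt) Ii /(b_sub B Ii).
Qed.

(** If a single trail ends at [w] instead of a terminal, the new edge leads it on to
[te]. *)
Lemma linkable_through q b : w != t -> bunch g A2 I t q -> I b ->
  target t (q b) = w -> (forall i, I i -> i != b -> away T t (target t (q i))) ->
  linkable T g' A' t.
Proof.
move=> wt B Ib tb tq; have B' := bunch_reattach B.
have Bq : bunch g' A' I t (upd q b (q b ++ [:: (e, te)])).
  apply: bunch_append; rewrite //= ?tb ?g'e // => c; rewrite inE => /eqP-> //.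
  by case=> i Ii /(b_sub B Ii)/andP[_]; rewrite inE eqxx.
exists (upd q b (q b ++ [:: (e, te)])); split.
  apply: (bunch_weak Bq) => [i|i c]; first exact: star_reattach.
  by move=> /(star_reattach wt) Ii /(b_sub Bq Ii).
move=> i /(star_reattach wt) Ii; have [->|ib] := eqVneq i b.
  by rewrite upd_same target_cat.
by rewrite upd_other // tq.
Qed.

Lemma bunch_delete q l : bunch g A I t q -> {in l, forall c, ~ used I q c} ->
  bunch g (delete A l) I t q.
Proof.
move=> B nl; apply: (bunch_weak B) => // i c Ii ci; split=> //.
by rewrite /delete (b_sub B Ii ci); apply/negP => /nl; apply; exists i.
Qed.

Lemma linkable_unused q : w != t -> linking T g A t q -> ~ used I q e ->
  ~ used I q f -> linkable T g' A' t.
Proof.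
move=> wt [B tB] ne nf; apply: linkable_avoid tB => //.
by apply: bunch_delete => // c; rewrite !inE => /orP[]/eqP->.
Qed.

(** The trail of [i] is continued from [v] along idle edges to [z]; it gives up its
remainder [tl]. *)
Lemma bunch_reroute q i h tl k z : linking T g A t q -> I i -> q i = h ++ tl ->
  target t h = v -> ~ used I q k -> reach g (idle g A t q k) v z ->
  exists s, bunch g (delete A (k :: edges tl)) I t (upd q i s) /\ target t s = z.
Proof.
move=> [B tB] Ii def_q th nk /reach_uniq[s [ws Fs ts us]].
have hn : h != [::] by apply: contra_neq vt => h0; rewrite -th h0.
have Bh := bunch_prefix B Ii def_q hn.
have sub j c : I j -> c \in edges (upd q i h j) -> c \in edges (q j).
  move=> Ij; rewrite /upd; case: eqP => [->|//].
  by rewrite def_q edges_cat mem_cat => ->.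
have tl_h j c : I j -> c \in edges (upd q i h j) -> c \notin edges tl.
  move=> Ij cj; apply/negP => ct; have cj' := sub _ _ Ij cj.
  have ci : c \in edges (q i) by rewrite def_q edges_cat mem_cat ct orbT.
  have ji := b_disj B Ij Ii cj' ci; move: cj; rewrite ji upd_same => ch.
  have := b_uniq B Ii; rewrite def_q edges_cat cat_uniq => /and3P[_ /hasPn/(_ c ct)].
  by rewrite /= ch.
have Bh' : bunch g (delete A (k :: edges tl)) I t (upd q i h).
  apply: (bunch_delete Bh) => c; rewrite inE => /orP[/eqP->|ct] [j Ij cj].
    by apply: nk; exists j; last exact: sub.
  by have := tl_h _ _ Ij cj; rewrite ct.
have un c : c \in edges s -> ~ used I q c.
  by move=> /Fs/and3P[_ _ /asboolP].
exists (h ++ s); split; last by rewrite target_cat th.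
have -> : upd q i (h ++ s) = upd (upd q i h) i (upd q i h i ++ s).
  by apply/funext => j; rewrite upd_same /upd; case: eqP.
apply: bunch_append => //; rewrite ?upd_same ?th //.
  move=> c cs; have /and3P[Ac ck _] := Fs c cs.
  rewrite /delete Ac inE (negPf ck) /=; apply/negP => ct.
  by apply: (un c cs); exists i; rewrite // def_q edges_cat mem_cat ct orbT.
by move=> c cs [j Ij cj]; apply: (un c cs); exists j; last exact: sub.
Qed.

(** A trail is to be stopped at [v] before its last edge [e], while [f] is idle.  Idle
edges may lead on to a terminal, or to [w] and from there along the new edge;
otherwise [shift_linking] applies. *)
Lemma linkable_last q i h : w != t -> linking T g A t q -> I i ->
  q i = h ++ [:: (e, te)] -> target t h = v -> ~ used I q f ->
  linkable T g' A' t.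
Proof.
move=> wt Lq Ii def_q th nf.
have sub2 J p : bunch g (delete A [:: f; e]) J t p -> bunch g A2 J t p.
  move=> B; apply: (bunch_weak B) => // j c Jj cj; split=> //.
  apply: delete_sub (b_sub B Jj cj) => d; rewrite !inE orbC //.
have [[z [rz zz]]|no] := pselect (exists z, reach g (idle g A t q f) v z /\
    (away T t z \/ z = w)); last first.
  have [|q' [[B' tB'] av]] := shift_linking gA Lq Tt Ii def_q th Tv Af jf nf.
    by move=> z rz zz; apply: no; exists z.
  apply: linkable_avoid tB' => //; apply: sub2; apply: bunch_delete => //.
  move=> c cl [j Ij cj]; have [] := av j c Ij cj; move: cl.
  by rewrite !inE => /orP[]/eqP->; rewrite ?eqxx.
have [s [/sub2 B ts]] := bunch_reroute Lq Ii def_q th nf rz.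
have oth j : I j -> j != i -> away T t (target t (upd q i s j)).
  by move=> Ij ji; rewrite upd_other // (proj2 Lq).
case: zz => [az|zw].
  apply: linkable_avoid B _ => // j Ij; have [->|/oth] := eqVneq j i; last exact.
  by rewrite upd_same ts.
by apply: linkable_through B Ii _ oth => //; rewrite upd_same ts.
Qed.

(** The symmetric situation: a trail is to be stopped at [v] before [f], while [e] is
idle; now reaching [te] is reaching a terminal. *)
Lemma linkable_forward q i h tl : w != t -> linking T g A t q -> I i ->
  q i = h ++ (f, w) :: tl -> target t h = v -> ~ used I q e ->
  linkable T g' A' t.
Proof.
move=> wt Lq Ii def_q th ne.
have sub2 J p : bunch g (delete A (e :: f :: edges tl)) J t p -> bunch g A2 J t p.
  move=> B; apply: (bunch_weak B) => // j c Jj cj; split=> //.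
  by apply: delete_sub (b_sub B Jj cj) => d; rewrite !inE => /orP[]->; rewrite ?orbT.
have [[z [rz zz]]|no] := pselect (exists z, reach g (idle g A t q e) v z /\
    (away T t z \/ z = te)); last first.
  have jev : joins g e v te by rewrite joinsC.
  have [|q' [[B' tB'] av]] := shift_linking gA Lq Tt Ii def_q th Tv Ae jev ne.
    by move=> z rz zz; apply: no; exists z.
  apply: linkable_avoid tB' => //; apply: bunch_delete => //.
  move=> c cl [j Ij cj]; have [] := av j c Ij cj; move: cl.
  by rewrite !inE => /orP[]/eqP->; rewrite ?eqxx.
have [s [/sub2 B ts]] := bunch_reroute Lq Ii def_q th ne rz.
apply: linkable_avoid B _ => // j Ij; have [->|ji] := eqVneq j i.
  by rewrite upd_same ts; case: zz => [//|->].
by rewrite upd_other // (proj2 Lq).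
Qed.

Lemma last_edge p i : linking T g A t p -> inner_free T t (p i) -> I i ->
  e \in edges (p i) -> exists h, p i = h ++ [:: (e, te)] /\ target t h = v.
Proof.
move=> [B tB] fr Ii ei; have [h [z [tl def_p]]] := mem_split ei.
have wp := b_walk B Ii; rewrite def_p walk_cat /= in wp; case/and3P: wp => _ jz _.
have [[hte _]|[hv zte]] := joins_pair jz je.
  exfalso; have [h0|hn] := eqVneq h [::].
    by move: tet; rewrite -hte h0 eqxx.
  by have := fr _ _ _ def_p hn; rewrite hte Te.
exists h; split=> //; case: tl def_p => [|d tl] def_p; first by rewrite def_p zte.
rewrite -cat_rcons in def_p; have := fr _ _ _ def_p.
by rewrite target_rcons zte Te -size_eq0 size_rcons => /(_ isT).
Qed.

(** Inspect how a linking of [t] without inner terminals uses [e] and [f].  A trail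
contains [e] only as its last edge, coming from [v].  A trail that takes [f] from [w]
to [v] can turn at [w] into the new edge, and its remainder from [v] is left to a
trail stopped at [v], if there is one.  If it takes [f] from [v] to [w], then it has
to stop at [v], and the lemmas above apply, according to whether [e] is idle, is
on the same trail, or ends another one.  The case that [w] is [t] itself is
special, because then [e] replaces [f] as an edge at [t]. *)
Lemma split_off : linkable T g A t -> linkable T g' A' t \/
  exists p Y i h, [/\ linking T g A t p, forall j, I j -> inner_free T t (p j),
    barrier T g A t p Y, I i & [/\ p i = h ++ [:: (e, te)], target t h = v & Y v]].
Proof.
move=> /(tame_linking lA)[p [Lp fr]]; have [B tB] := Lp.
have elast i : I i -> e \in edges (p i) ->
    exists h, p i = h ++ [:: (e, te)] /\ target t h = v.
  by move=> Ii; exact: (last_edge Lp (fr _ Ii) Ii).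
have [wt|wt] := eqVneq w t.
  have If : I f by rewrite /I /star Af (joins_inc _ jf) wt eqxx orbT.
  have [z [b def_pf]] := b_head B If.
  have zv : z = v.
    have := b_walk B If; rewrite def_pf /= => /andP[jz _].
    by apply: joins_inj jz _; rewrite joinsC -wt.
  rewrite {}zv in def_pf.
  pose J i := I i && (i != f).
  have final q : bunch g A2 J t q -> (forall i, J i -> away T t (target t (q i))) ->
      linkable T g' A' t.
    move=> Bq tq; have B' := bunch_reattach Bq.
    (* As [w] is [t], the edge [e] joins the edges at [t] and [f] leaves them. *)
    have dom i : star g' A' t i -> i = e \/ (i != e /\ J i).
      move=> /andP[/andP[Ai]]; rewrite inE => fi /=.
      have [->|ie] := eqVneq i e; [by left|right; split=> //].
      by move: b0; rewrite /J fi /I /star Ai /inc /g' /reattach (negPf ie) => ->.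
    have ne i : J i -> e \in edges (q i) -> False.
      by move=> Ji /(b_sub Bq Ji)/andP[_]; rewrite inE eqxx.
    exists (upd q e [:: (e, te)]); split; last first.
      move=> i /dom[->|[ie Ji]]; first by rewrite upd_same.
      by rewrite upd_other // tq.
    split.
    - move=> i /dom[->|[ie Ji]]; last by rewrite upd_other // (b_walk B' Ji).
      by rewrite upd_same /= -wt g'e.
    - move=> i /dom[->|[ie Ji]]; last by rewrite upd_other //; exact: (b_head B' Ji).
      by rewrite upd_same; exists te, [::].
    - move=> i c /dom[->|[ie Ji]]; last by rewrite upd_other //; exact: (b_sub B' Ji).
      by rewrite upd_same inE => /eqP->.
    - move=> i /dom[->|[ie Ji]]; last by rewrite upd_other // (b_uniq B' Ji).
      by rewrite upd_same.
    - move=> i j c /dom[->|[ie Ji]] /dom[->|[je' Jj]] //.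
      + by rewrite upd_same upd_other // inE => /eqP-> /(ne _ Jj).
      + by rewrite upd_same upd_other // inE => + /eqP cE; rewrite cE => /(ne _ Ji).
      + by rewrite !upd_other //; exact: (b_disj B' Ji Jj).
  left; have JI i : J i -> I i by case/andP.
  have fself i : J i -> f \in edges (p i) -> False.
    by case/andP => Ii fi ff; rewrite (b_disj B Ii If ff (bunch_self B If)) eqxx in fi.
  have [[i1 I1 e1]|ne] := pselect (used I p e); last first.
    apply: (final p) => [|i /JI]; last exact: tB.
    apply: (bunch_weak B) => // i c Ji ci; split=> //.
    rewrite /A2 /delete (b_sub B (JI _ Ji) ci) !inE negb_or /=; apply/andP; split.
      by apply/eqP => ce; rewrite ce in ci; apply: ne; exists i => //; exact: JI.
    by apply/eqP => cf; rewrite cf in ci; exact: (fself i Ji ci).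
  have [h1 [def_p1 th1]] := elast _ I1 e1.
  have h1n : h1 != [::] by apply: contra_neq vt => h10; rewrite -th1 h10.
  have e_only i : I i -> i != i1 -> e \in edges (p i) -> False.
    by move=> Ii ii ei; rewrite (b_disj B Ii I1 ei e1) eqxx in ii.
  (* If the trail of [f] ends with [e], the new edge alone replaces it; if another
     trail ends with [e], then it takes over the remainder of the trail of [f]. *)
  have [i1f|i1f] := eqVneq i1 f.
    apply: (final p) => [|i /JI]; last exact: tB.
    apply: (bunch_weak B) => // i c Ji ci; split=> //.
    rewrite /A2 /delete (b_sub B (JI _ Ji) ci) !inE negb_or /=; apply/andP; split.
      apply/eqP => ce; rewrite ce in ci; apply: (e_only i (JI _ Ji) _ ci).
      by rewrite i1f; case/andP: Ji.
    by apply/eqP => cf; rewrite cf in ci; exact: (fself i Ji ci).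
  have Bh := bunch_prefix B I1 def_p1 h1n.
  have J1 : J i1 by rewrite /J I1.
  have eh1 : e \notin edges h1.
    have := b_uniq B I1; rewrite def_p1 edges_cat cat_uniq /= orbF.
    by case/and3P.
  have sub i c : c \in edges (upd p i1 h1 i) -> c \in edges (p i).
    by rewrite /upd; case: eqP => [->|//]; rewrite def_p1 edges_cat mem_cat => ->.
  have BhJ : bunch g A2 J t (upd p i1 h1).
    apply: (bunch_weak Bh) => // i c Ji ci; split=> //.
    rewrite /A2 /delete (b_sub Bh (JI _ Ji) ci) !inE negb_or /=; apply/andP; split.
      apply/eqP => ce; rewrite {}ce in ci; have [ii|ii] := eqVneq i i1.
        by move: ci; rewrite ii upd_same; apply/negP.
      by apply: (e_only i (JI _ Ji) ii); exact: sub.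
    by apply/eqP => cf; rewrite cf in ci; exact: (fself i Ji (sub _ _ ci)).
  have wb := b_walk B If; rewrite def_pf /= in wb; case/andP: wb => _ wb.
  have ub := b_uniq B If; rewrite def_pf /= in ub; case/andP: ub => fb ub.
  have bf c : c \in edges b -> c \in edges (p f) by rewrite def_pf inE => ->; rewrite orbT.
  have nb c : c \in edges b -> ~ used J (upd p i1 h1) c.
    move=> cb [i Ji /sub ci]; case/andP: Ji => Ii.
    by rewrite (b_disj B Ii If ci (bf _ cb)) eqxx.
  apply: (final (upd (upd p i1 h1) i1 (upd p i1 h1 i1 ++ b))).
    apply: bunch_append => //; first by rewrite upd_same th1.
    move=> c cb; rewrite /A2 /delete (b_sub B If (bf _ cb)) !inE negb_or /=.
    apply/andP; split; last by apply: contraNneq fb => <-.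
    apply: contra i1f => /eqP ce; rewrite ce in cb.
    by apply/eqP; apply: (b_disj B I1 If e1 (bf _ cb)).
  move=> i Ji; have [->|ii] := eqVneq i i1; last by rewrite !upd_other //; exact/tB/JI.
  rewrite !upd_same target_cat th1.
  by have := tB _ If; rewrite def_pf.
have [[i2 I2 f2]|nf] := pselect (used I p f); last first.
  left; have [[i1 I1 e1]|ne] := pselect (used I p e); last exact: (linkable_unused wt Lp ne nf).
  have [h1 [def_p1 th1]] := elast _ I1 e1.
  exact: (linkable_last wt Lp I1 def_p1 th1 nf).
have [h2 [z [tl2 def_p2]]] := mem_split f2.
have u2 := b_uniq B I2.
(* The two directions in which the trail of [i2] can take [f]. *)
have [[h2v zw]|[h2w zv]] : (target t h2 = v /\ z = w) \/ (target t h2 = w /\ z = v).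
- have := b_walk B I2; rewrite def_p2 walk_cat /= => /and3P[_ jz _].
  by have [[-> ->]|[-> ->]] := joins_pair jz jf; [left|right].
- rewrite {}zw in def_p2.
  have h2n : h2 != [::] by apply: contra_neq vt => h20; rewrite -h2v h20.
  have [[i1 I1 e1]|ne] := pselect (used I p e); last first.
    by left; exact: (linkable_forward wt Lp I2 def_p2 h2v ne).
  have [h1 [def_p1 th1]] := elast _ I1 e1.
  have [i12|i12] := eqVneq i1 i2; last first.
    have [[Y [bY Yv]]|[q [Lq [nf [i [h [Ii def_q th]]]]]]] :=
        augment_or_barrier lA Lp Tt I1 I2 i12 def_p1 th1 Tv def_p2 h2v.
      by right; exists p, Y, i1, h1.
    by left; exact: (linkable_last wt Lq Ii def_q th nf).
  have eh2 : e \notin edges h2.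
    apply/negP => eh; have [a1 [y [a2 def_h2]]] := mem_split eh.
    move: u2 def_p2; rewrite -i12 def_p1 => u1; rewrite def_h2 -catA /= => def_p2.
    by have [_ _] := split_uniq u1 def_p2; case: a2 {def_h2 def_p2}.
  have Bh := bunch_prefix B I2 def_p2 h2n.
  have sub i c : c \in edges (upd p i2 h2 i) -> c \in edges (p i).
    by rewrite /upd; case: eqP => [->|//]; rewrite def_p2 edges_cat mem_cat => ->.
  have ne : ~ used I (upd p i2 h2) e.
    case=> i Ii ei; have ii := b_disj B Ii I1 (sub _ _ ei) e1.
    by move: ei; rewrite ii i12 upd_same; apply/negP.
  have Bq : bunch g A I t (upd (upd p i2 h2) i2 (upd p i2 h2 i2 ++ [:: (e, te)])).
    apply: bunch_append => //=; first by rewrite upd_same h2v joinsC je.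
      by move=> c; rewrite inE => /eqP->.
    by move=> c; rewrite inE => /eqP->.
  left; apply: (@linkable_last _ i2 h2 wt (conj Bq _) I2); rewrite ?upd_same //.
    move=> i Ii; have [->|ii] := eqVneq i i2; last by rewrite !upd_other // tB.
    by rewrite !upd_same target_cat.
  have fh2 : f \notin edges h2.
    move: u2; rewrite def_p2 edges_cat cat_uniq /= negb_or.
    by case/and4P => _ /andP[].
  case=> i Ii; have [->|ii] := eqVneq i i2; last first.
    by rewrite !upd_other // => fi; move: ii; rewrite (b_disj B Ii I2 fi f2) eqxx.
  by rewrite !upd_same edges_cat mem_cat inE (negPf fh2) eq_sym (negPf ef).
rewrite {}zv in def_p2.
have h2n : h2 != [::] by apply: contra_neq wt => h20; rewrite -h2w h20.
have fh2 : f \notin edges h2.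
  move: u2; rewrite def_p2 edges_cat cat_uniq /= negb_or.
  by case/and4P => _ /andP[].
have Bh := bunch_prefix B I2 def_p2 h2n.
have sub i c : c \in edges (upd p i2 h2 i) -> c \in edges (p i).
  by rewrite /upd; case: eqP => [->|//]; rewrite def_p2 edges_cat mem_cat => ->.
have nf : ~ used I (upd p i2 h2) f.
  case=> i Ii fi; have ii := b_disj B Ii I2 (sub _ _ fi) f2.
  by move: fi; rewrite ii upd_same; apply/negP.
left; have [[i1 I1 e1]|ne] := pselect (used I p e); last first.
  have ne' : ~ used I (upd p i2 h2) e by case=> i Ii /sub ei; apply: ne; exists i.
  apply: (@linkable_through (upd p i2 h2) i2 wt) => //; last 2 first.
  - by rewrite upd_same.
  - by move=> i Ii ii; rewrite upd_other // tB.
  by apply: bunch_delete => // c; rewrite !inE => /orP[]/eqP->.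
have [h1 [def_p1 th1]] := elast _ I1 e1.
have [i12|i12] := eqVneq i1 i2.
  have eh2 : e \notin edges h2.
    apply/negP => eh; have [a1 [y [a2 def_h2]]] := mem_split eh.
    move: u2 def_p2; rewrite -i12 def_p1 => u1; rewrite def_h2 -catA /= => def_p2.
    by have [_ _] := split_uniq u1 def_p2; case: a2 {def_h2 def_p2}.
  have ne : ~ used I (upd p i2 h2) e.
    case=> i Ii ei; have ii := b_disj B Ii I1 (sub _ _ ei) e1.
    by move: ei; rewrite ii i12 upd_same; apply/negP.
  apply: (@linkable_through (upd p i2 h2) i2 wt) => //; last 2 first.
  - by rewrite upd_same.
  - by move=> i Ii ii; rewrite upd_other // tB.
  by apply: bunch_delete => // c; rewrite !inE => /orP[]/eqP->.
have h1n : h1 != [::] by apply: contra_neq vt => h10; rewrite -th1 h10.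
have B1 := bunch_prefix B I1 def_p1 h1n.
have def_p2' : upd p i1 h1 i2 = h2 ++ (f, v) :: tl2 by rewrite upd_other // eq_sym.
(* The trail of [i2] stops at [w], to go on along the new edge, while that of [i1]
   stops at [v] and takes over the remainder of the trail of [i2]. *)
have B12 : bunch g A I t (upd (upd (upd p i1 h1) i2 h2) i1 (upd p i1 h1 i1 ++ tl2)).
  by apply: (bunch_swap B1 I1 I2 i12 def_p2' h2n); rewrite upd_same.
set q := upd _ i1 _ in B12.
have q1 : q i1 = h1 ++ tl2 by rewrite /q !upd_same.
have q2 : q i2 = h2 by rewrite /q upd_other 1?eq_sym // upd_same.
have qo i : i != i1 -> i != i2 -> q i = p i by move=> n1 n2; rewrite /q !upd_other.
have tl2p c : c \in edges tl2 -> c \in edges (p i2).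
  by move=> ct; rewrite def_p2 edges_cat mem_cat inE ct !orbT.
have h2p c : c \in edges h2 -> c \in edges (p i2).
  by move=> ch; rewrite def_p2 edges_cat mem_cat ch.
have h1p c : c \in edges h1 -> c \in edges (p i1).
  by move=> ch; rewrite def_p1 edges_cat mem_cat ch.
have eh1 : e \notin edges h1.
  have := b_uniq B I1; rewrite def_p1 edges_cat cat_uniq /= orbF.
  by case/and3P.
have ftl : f \notin edges tl2.
  by move: u2; rewrite def_p2 edges_cat cat_uniq /= => /and4P[].
have absurd_e i : I i -> i != i1 -> e \in edges (p i) -> False.
  by move=> Ii + ei; rewrite (b_disj B Ii I1 ei e1) eqxx.
have absurd_f i : I i -> i != i2 -> f \in edges (p i) -> False.
  by move=> Ii + fi; rewrite (b_disj B Ii I2 fi f2) eqxx.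
apply: (@linkable_through q i2 wt) => //.
  apply: bunch_delete => // c; rewrite !inE => /orP[]/eqP-> [i Ii];
    have [->|n1] := eqVneq i i1; rewrite ?q1 ?edges_cat ?mem_cat;
    try (have [->|n2] := eqVneq i i2; rewrite ?q2 ?qo //).
  - by rewrite (negPf eh1) => /tl2p; apply: absurd_e; rewrite // eq_sym.
  - by move=> /h2p; apply: absurd_e; rewrite // eq_sym.
  - exact: absurd_e.
  - by rewrite (negPf ftl) orbF => /h1p; exact: absurd_f.
  - exact/negP.
  - exact: absurd_f.
  by rewrite q2.
move=> i Ii i_2; have [->|n1] := eqVneq i i1; last by rewrite qo // tB.
rewrite q1 target_cat th1; have := tB _ I2.
by rewrite def_p2 target_cat.
Qed.

End Split.

(** * Removing one path while every terminal stays linkable *)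

Section Peel.
Variables V E : choiceType.
Variable T : pred V.
Implicit Types (g : E -> V * V) (x y z t v w u : V) (e f i j k c d : E).
Implicit Types (s h tl : seq (E * V)) (X Y : pred V) (A I F : pred E).
Implicit Types (p q r : E -> seq (E * V)).

Lemma edges_cons c x s : edges ((c, x) :: s) = c :: edges s.
Proof. by []. Qed.

Lemma linkable_congr g g' A A' t : A =1 A' -> (forall c, A c -> g c = g' c) ->
  linkable T g A t -> linkable T g' A' t.
Proof.
move=> /funext AA gg [p [B tB]]; exists p; rewrite -AA.
have dom i : star g' A t i -> star g A t i.
  by move=> /andP[Ai]; rewrite /star Ai /inc gg.
split=> [|i /dom]; last exact: tB.
by apply: (bunch_weak B) => // i c /dom Ii /(b_sub B Ii) Ac; split=> //; exact: gg.
Qed.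

Lemma linkable_delete g A t p l : linking T g A t p ->
  (forall i c, star g (delete A l) t i -> c \in edges (p i) -> c \notin l) ->
  linkable T g (delete A l) t.
Proof.
move=> [B tB] nl; exists p.
have dom i : star g (delete A l) t i -> star g A t i.
  by move=> /andP[/andP[Ai _]]; rewrite /star Ai.
split=> [|i /dom]; last exact: tB.
apply: (bunch_weak B) => // i c Ii ci; split=> //.
by rewrite /delete (b_sub B (dom _ Ii) ci) (nl _ _ Ii ci).
Qed.

Lemma walk_within g (P : pred V) x s e : walk g x s ->
  {in x :: unzip2 s, forall y, P y} -> e \in edges s -> P (g e).1 && P (g e).2.
Proof.
move=> ws sP es; rewrite !sP //; apply: (walk_ends ws es); rewrite /inc eqxx //.
by rewrite orbT.
Qed.

Lemma first_in (Y : pred V) x s : ~~ Y x -> {in x :: unzip2 s, forall y, ~~ Y y} \/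
  exists a c z b, [/\ s = a ++ (c, z) :: b, {in x :: unzip2 a, forall y, ~~ Y y} & Y z].
Proof.
elim: s x => [|[c z] s IH] x nx.
  by left => y; rewrite inE => /eqP->.
have [Yz|nz] := boolP (Y z).
  right; exists [::], c, z, s; split=> // y; rewrite inE => /eqP->//.
have [al|[a [d [z' [b [-> al Yz']]]]]] := IH z nz.
  by left=> y; rewrite inE => /orP[/eqP->//|]; exact: al.
right; exists ((c, z) :: a), d, z', b; split=> // y.
by rewrite inE => /orP[/eqP->//|]; exact: al.
Qed.

Section Barrier.
Variables (g : E -> V * V) (A : pred E) (t : V) (p : E -> seq (E * V)).
Variables (Y : pred V) (i1 e : E) (h1 : seq (E * V)) (te v : V).
Hypotheses (lA : loopless g A) (Lp : linking T g A t p) (Tt : T t).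
Hypothesis bY : barrier T g A t p Y.
Let I := star g A t.
Hypotheses (I1 : I i1) (def_p1 : p i1 = h1 ++ [:: (e, te)]).
Hypotheses (th1 : target t h1 = v) (Yv : Y v).

Let B : bunch g A I t p := proj1 Lp.
Let Yt : Y t. Proof. by rewrite (ba_T bY Tt). Qed.

(** A trail which never enters [Y] consists of a part inside [Y], one edge of the cut
and a part outside. *)
Lemma out_stays i s1 s2 : I i -> p i = s1 ++ s2 -> ~~ Y (target t s1) ->
  {in unzip2 s2, forall y, ~~ Y y}.
Proof.
move=> Ii; elim: s2 s1 => [|[c x] s2 IH] s1 //= def_p Ys y.
have Yx := ba_out bY Ii def_p Ys.
rewrite inE => /orP[/eqP->//|]; apply: (IH (rcons s1 (c, x))).
  by rewrite cat_rcons.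
by rewrite target_rcons.
Qed.

Lemma in_before i h tl : I i -> p i = h ++ tl -> Y (target t h) ->
  {in t :: unzip2 h, forall y, Y y}.
Proof.
move=> Ii def_p Yh y /vertex_split[s1 [s2 [def_h ty]]].
apply: contraT => nY; have := @out_stays i s1 (s2 ++ tl) Ii.
rewrite catA -def_h ty => /(_ def_p nY); move: Yh; rewrite def_h target_cat ty.
have [->|s2n] := eqVneq s2 [::]; first by rewrite /target /= (negPf nY).
move=> Ys /(_ (target y s2)); rewrite Ys; apply.
by rewrite /unzip2 map_cat mem_cat [X in X || _](target_mem y s2n).
Qed.

Lemma crossing_split c : A c -> crosses g Y c -> exists j h x tl,
  [/\ I j, p j = h ++ (c, x) :: tl, {in t :: unzip2 h, forall y, Y y}, ~~ Y x
    & {in unzip2 tl, forall y, ~~ Y y}].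
Proof.
move=> Ac cc; have [j Ij cj] := ba_cover bY Ac cc.
have [h [x [tl def_p]]] := mem_split cj; exists j, h, x, tl.
have jc : joins g c (target t h) x.
  by have := b_walk B Ij; rewrite def_p walk_cat /= => /and3P[].
have Yh : Y (target t h).
  apply: contraT => nY; move: cc; rewrite (joins_cross _ jc) (negPf nY) /=.
  by move=> Yx; have := ba_out bY Ij def_p nY; rewrite Yx.
have Yx : ~~ Y x by move: cc; rewrite (joins_cross _ jc) Yh.
split=> //; first exact: (in_before Ij def_p Yh).
apply: (@out_stays j (rcons h (c, x)) tl Ij); first by rewrite cat_rcons.
by rewrite target_rcons.
Qed.

Definition inside c := Y (g c).1 && Y (g c).2.

Lemma inside_cross c : inside c -> crosses g Y c = false.
Proof. by case/andP; rewrite /crosses => -> ->. Qed.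

Lemma crossing_unique j c d : I j -> c \in edges (p j) -> d \in edges (p j) ->
  crosses g Y c -> crosses g Y d -> c = d.
Proof.
move=> Ij cj dj cc cd.
have [j' [h [x [tl [Ij' def_p hY Yx tlY]]]]] := crossing_split (b_sub B Ij cj) cc.
have cj' : c \in edges (p j') by rewrite def_p edges_cat mem_cat inE eqxx orbT.
have jj := b_disj B Ij' Ij cj' cj; rewrite {}jj in def_p cj'.
have := b_walk B Ij; rewrite def_p walk_cat /= => /and3P[wh _ wtl].
move: dj; rewrite def_p edges_cat mem_cat inE => /or3P[dh|/eqP->//|dtl].
  by move: cd; rewrite inside_cross // /inside (walk_within wh hY dh).
have xtl : {in x :: unzip2 tl, forall y, ~~ Y y}.
  by move=> y; rewrite inE => /orP[/eqP->//|]; exact: tlY.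
have := @walk_within _ (predC Y) _ _ _ wtl xtl dtl; move: cd; rewrite /crosses /=.
by case: (Y _); case: (Y _).
Qed.

Lemma joins_e : joins g e v te.
Proof.
by have := b_walk B I1; rewrite def_p1 walk_cat th1 /= andbT => /andP[].
Qed.

Lemma outside_p1 c : c \in edges (p i1) -> ~~ inside c -> c = e.
Proof.
move=> c1; rewrite {1}def_p1 in c1; move: c1.
rewrite edges_cat mem_cat inE => /orP[ch|/eqP//].
have := b_walk B I1; rewrite def_p1 walk_cat => /andP[wh _].
have hY : {in t :: unzip2 h1, forall y, Y y}.
  by apply: (in_before I1 def_p1); rewrite th1.
by rewrite /inside (walk_within wh hY ch).
Qed.

(** A trail of a linking of [t2] that meets [Y] is stopped at its first entrance into
[Y], through an edge [c] say, and then follows backwards to [t] the trail of [p] that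
leaves [Y] through [c].  Distinct trails enter through distinct edges and thus
follow distinct trails of [p]; and the trail of [i1], which leaves [Y] through the
edge [e] to a terminal, is never followed, since a trail without inner terminals
would enter through [e] only by starting with it. *)
Lemma linkable_reroute t2 : T t2 -> linkable T g A t2 ->
  linkable T g (delete A (edges (p i1))) t2.
Proof.
move=> Tt2; have [->|t2t] := eqVneq t2 t => [_|].
  apply: (linkable_delete Lp) => i c /andP[/andP[Ai i_1] it] ci.
  have Ii : I i by rewrite /I /star Ai.
  apply: contra i_1 => c1; rewrite -(b_disj B Ii I1 ci c1).
  exact: (bunch_self B Ii).
move=> /(tame_linking lA)[r [[Br tr] fr]].
set A' := delete A _; pose J := star g A' t2.
have JA i : J i -> star g A t2 i by case/andP => /andP[Ai _]; rewrite /star Ai.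
have Yt2 : ~~ Y t2 by rewrite (ba_T bY Tt2).
have e1 : e \in edges (p i1) by rewrite def_p1 edges_cat mem_cat inE eqxx orbT.
(* A trail cannot come to [Y] through [e]: it would have to come from the terminal
   [te], hence start there, and then be the trail of the deleted edge [e]. *)
have not_e i a x b : J i -> r i = a ++ (e, x) :: b -> ~~ Y (target t2 a) -> False.
  move=> Ji def_r nY; have Ii := JA _ Ji.
  have := b_walk Br Ii; rewrite def_r walk_cat /= => /and3P[_ ja _].
  have [[av _]|[ate _]] := joins_pair ja joins_e; first by rewrite av Yv in nY.
  have Tte : T te by have := proj2 Lp _ I1; rewrite def_p1 target_cat => /andP[].
  have [a0|an] := eqVneq a [::]; last first.
    by have := fr _ Ii _ _ _ def_r an; rewrite ate Tte.
  have [y [s def_r']] := b_head Br Ii; move: def_r'; rewrite def_r a0 => -[ei _ _].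
  by case/andP: Ji => /andP[_]; rewrite -ei e1.
pose spec i s := [/\ walk g t2 s, exists y s', s = (i, y) :: s', uniq (edges s),
    away T t2 (target t2 s)
  & forall c, c \in edges s -> A' c /\
      ((~~ inside c /\ c \in edges (r i)) \/
       (inside c /\ exists j d, [/\ I j, c \in edges (p j), d \in edges (p j),
          d \in edges (r i) & crosses g Y d]))].
suff /choice[q qP] : forall i, exists s, J i -> spec i s.
  exists q; split; last by move=> i /qP[].
  split; try by move=> i /qP[].
  - by move=> i c /qP[_ _ _ _ H] /H[].
  - move=> i j c Ji Jj; case/qP: (Ji) => _ _ _ _ H; case/qP: (Jj) => _ _ _ _ H'.
    move=> /H[_ {}H] /H'[_ {}H']; have [Ii Ij] := (JA _ Ji, JA _ Jj).
    case: H => [[nc ci]|[inc_ [m [d [Im cm dm di dY]]]]];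
    case: H' => [[nc' cj]|[inc' [m' [d' [Im' cm' dm' dj dY']]]]].
    + exact: (b_disj Br Ii Ij ci cj).
    + by rewrite inc' in nc.
    + by rewrite inc_ in nc'.
    + have mm := b_disj B Im Im' cm cm'; rewrite -{}mm in dm'.
      have dd := crossing_unique Im dm dm' dY dY'; rewrite -{}dd in dj.
      exact: (b_disj Br Ii Ij di dj).
move=> i; have [Ji|] := boolP (J i); last by exists [::].
have Ii := JA _ Ji; have wr := b_walk Br Ii; have ur := b_uniq Br Ii.
have [al|[a [c [x [b [def_r al Yx]]]]]] := first_in (r i) Yt2.
  exists (r i) => _; split=> //; [exact: (b_head Br Ii)|exact: tr|].
  move=> c ci; have nc := @walk_within _ (predC Y) _ _ _ wr al ci.
  have nin : ~~ inside c by case/andP: nc => /= n1 _; rewrite /inside (negPf n1).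
  split; last by left.
  rewrite /A' /delete (b_sub Br Ii ci); apply/negP => c1.
  have ce := outside_p1 c1 nin; rewrite {}ce in ci.
  have [a [x [b def_r]]] := mem_split ci; apply: (not_e _ _ _ _ Ji def_r).
  apply: al; rewrite def_r /unzip2 map_cat -cat_cons mem_cat.
  by rewrite /target mem_last.
have := wr; rewrite def_r walk_cat /= => /and3P[wa jc _].
have nYa : ~~ Y (target t2 a) by apply: al; rewrite /target mem_last.
have cr : c \in edges (r i) by rewrite def_r edges_cat mem_cat inE eqxx orbT.
have cc : crosses g Y c by rewrite (joins_cross _ jc) Yx (negPf nYa).
have [j [h [y [tl [Ij def_p hY Yy tlY]]]]] := crossing_split (b_sub Br Ii cr) cc.
have := b_walk B Ij; rewrite def_p walk_cat /= => /and3P[wh jc' _].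
have Yh : Y (target t h) by apply: hY; rewrite /target mem_last.
have hx : target t h = x.
  have [[ha _]|[_ //]] := joins_pair jc' jc.
  by move: nYa; rewrite -ha Yh.
have ce : c != e.
  by apply/eqP => ce; move: def_r; rewrite ce => def_r; exact: (not_e _ _ _ _ Ji def_r nYa).
have cj : c \in edges (p j) by rewrite def_p edges_cat mem_cat inE eqxx orbT.
have nin_c : ~~ inside c by apply/negP => /inside_cross; rewrite cc.
have j1 : j != i1.
  apply: contra ce => /eqP j1; rewrite j1 in cj; apply/eqP.
  exact: outside_p1.
have in_h d : d \in edges h -> inside d.
  by move=> dh; exact: (walk_within wh hY dh).
have out_a d : d \in edges a -> ~~ inside d.
  move=> da; have := @walk_within _ (predC Y) _ _ _ wa al da.
  by case/andP => /= n1 _; rewrite /inside (negPf n1).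
have not1 d : d \in edges (r i) -> ~~ inside d -> d != e -> A' d.
  move=> dr nd de; rewrite /A' /delete (b_sub Br Ii dr); apply: contra de => d1.
  by apply/eqP; exact: outside_p1.
have ar d : d \in edges a -> d \in edges (r i).
  by move=> da; rewrite def_r edges_cat mem_cat da.
exists (a ++ (c, x) :: rwalk t h) => _; split.
- by rewrite walk_cat wa /= jc -hx walk_rwalk.
- have [z [s]] := b_head Br Ii; rewrite def_r.
  by case: (a) => [|d a'] [-> _]; [exists x, (rwalk t h)|eexists; eexists].
- have := ur; rewrite def_r !edges_cat !edges_cons edges_rwalk !cat_uniq.
  case/and3P=> -> /= + _; rewrite !negb_or => /andP[-> _] /=.
  rewrite mem_rev rev_uniq.
  have := b_uniq B Ij; rewrite def_p edges_cat cat_uniq => /andP[-> _].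
  rewrite andbT; apply/andP; split; last by apply: contra nin_c => /in_h.
  apply/hasPn => d; rewrite mem_rev => /in_h; apply: contraL; exact: out_a.
- by rewrite target_cat /target /= -/(target _ _) -hx target_rwalk /away Tt eq_sym.
- move=> d; rewrite edges_cat mem_cat edges_cons inE edges_rwalk mem_rev => /or3P[da|/eqP->|dh].
  + split; last by left; split; [exact: out_a|exact: ar].
    apply: not1; [exact: ar|exact: out_a|].
    apply/eqP => de; have := da; rewrite {}de => ea.
    have [a1 [z [a2 def_a]]] := mem_split ea.
    apply: (@not_e i a1 z (a2 ++ (c, x) :: b) Ji); first by rewrite def_r def_a -catA.
    apply: al; rewrite def_a /unzip2 map_cat -cat_cons mem_cat.
    by rewrite /target mem_last.
  + by split; [exact: not1|left].
  + have dj : d \in edges (p j) by rewrite def_p edges_cat mem_cat dh.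
    split; last by right; split; [exact: in_h|exists j, c].
    rewrite /A' /delete (b_sub B Ij dj); apply: contra j1 => d1.
    by rewrite (b_disj B Ij I1 dj d1).
Qed.

End Barrier.

Lemma rwalk_cat x s1 s2 : rwalk x (s1 ++ s2) = rwalk (target x s1) s2 ++ rwalk x s1.
Proof.
elim: s1 x => [|[c y] s1 IH] x /=; first by rewrite cats0.
by rewrite IH rcons_cat.
Qed.

Lemma size_rwalk x s : size (rwalk x s) = size s.
Proof. by elim: s x => [|[c y] s IH] x //=; rewrite size_rcons IH. Qed.

Lemma inner_free_rwalk x s : inner_free T x s -> inner_free T (target x s) (rwalk x s).
Proof.
move=> fs u1 d u2 def_r u1n.
have le_u1 : size u1 < size s by rewrite -(size_rwalk x s) def_r size_cat /= addnS ltnS leq_addr.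
have def_s := cat_take_drop (size s - size u1) s.
set s1 := take _ s in def_s; set s2 := drop _ s in def_s.
have sz2 : size s2 = size u1 by rewrite size_drop subKn // ltnW.
move: def_r; rewrite -{1}def_s rwalk_cat => /eqP.
rewrite eqseq_cat ?size_rwalk // => /andP[/eqP<- _].
rewrite -{1}def_s target_cat target_rwalk.
case: s2 def_s sz2 => [|d2 s2] def_s sz2; first by case: (u1) u1n sz2.
apply: (fs _ _ _ (esym def_s)); rewrite -size_eq0 size_take_min.
by rewrite -lt0n leq_min subn_gt0 le_u1 /= (leq_ltn_trans _ le_u1).
Qed.

(** For a set of non-terminals, hence without [x], the new edge from [x] to [w]
crosses it if and only if exactly one of the old edges does. *)
Lemma parity_reattach g A e f x v w : parity T g A -> T x -> A e -> A f ->
  e != f -> joins g e x v -> joins g f v w ->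
  parity T (reattach g e x w) (delete A [:: f]).
Proof.
move=> gA Tx Ae Af ef je jf X XT oX; apply: (gA X XT).
have ul : uniq [:: e; f] by rewrite /= inE ef.
have Xx : X x = false by apply/negP => /XT; rewrite Tx.
apply: (oddset_change ul _ _ oX) => [c|].
  rewrite !inE negb_or => /andP[ce cf].
  by rewrite /delete inE cf andbT /crosses /reattach (negPf ce).
rewrite /= /delete !inE !eqxx ef Ae Af /= ?andbF /= (joins_cross _ je) (joins_cross _ jf).
rewrite /crosses /reattach eqxx /= Xx /=.
by case: (X w); case: (X v).
Qed.

(** Induction on the length of the trail that starts with [e] = [t v].  If [v] is a
terminal, this edge alone can be deleted, since no other trail without inner
terminals contains it.  Otherwise split off [e] and the next edge [f]: if all
terminals keep a linking, the trail found in the new graph is lifted by replacing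
the new edge by [e] and [f]; if not, [split_off] yields a barrier around [v], and
[linkable_reroute] shows that the trail of the barrier that ends with [e] can be
deleted, reversed so as to start at [t]. *)
Lemma peel_path n g A t e r : parity T g A -> loopless g A -> T t ->
  (forall t2, T t2 -> t2 != t -> linkable T g A t2) ->
  linking T g A t r -> (forall i, star g A t i -> inner_free T t (r i)) ->
  star g A t e -> size (r e) <= n ->
  exists s, [/\ walk g t s /\ (exists y s', s = (e, y) :: s'),
    uniq (edges s) /\ {in edges s, forall c, A c}, away T t (target t s), inner_free T t s
    & forall t2, T t2 -> linkable T g (delete A (edges s)) t2].
Proof.
elim: n g A r => [|n IH] g A r gA lA Tt lk Lr fr Ie.
  by have [y [s ->]] := b_head (proj1 Lr) Ie.
have [B tB] := Lr; have [v [rest def_r]] := b_head B Ie => le_n.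
have wr := b_walk B Ie; have ur := b_uniq B Ie; have Tr := tB _ Ie.
have Ae : A e by case/andP: Ie.
have je : joins g e t v by move: wr; rewrite def_r /= => /andP[].
have lk' t2 : T t2 -> linkable T g A t2.
  by move=> Tt2; have [->|nt] := eqVneq t2 t; [exists r|exact: lk].
have [Tv|Tv] := boolP (T v).
  have rest0 : rest = [::].
    case: rest def_r {wr ur Tr le_n} => // d rest def_r.
    by have := fr _ Ie [:: (e, v)] d rest def_r isT; rewrite /target /= Tv.
  exists (r e); split=> //.
  - by split=> //; exists v, rest.
  - by split=> // c; exact: (b_sub B Ie).
  - exact: fr.
  - move=> t2 Tt2; have [q [Lq fq]] := tame_linking lA (lk' _ Tt2).
    apply: (linkable_delete Lq) => i c /andP[/andP[Ai i_e] it] ci.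
    rewrite def_r rest0 /= inE; apply/eqP => ce; rewrite {}ce in ci.
    have Ii : star g A t2 i by rewrite /star Ai.
    have [Ie2|] := boolP (star g A t2 e).
      have ii := b_disj (proj1 Lq) Ii Ie2 ci (bunch_self (proj1 Lq) Ie2).
      by move: i_e; rewrite ii def_r inE eqxx.
    have [a [x [b def_q]]] := mem_split ci.
    have := b_walk (proj1 Lq) Ii; rewrite def_q walk_cat /= => /and3P[_ ja _].
    have [a0|an] := eqVneq a [::].
      by move: ja; rewrite a0 /star Ae /= => /joins_inc->; rewrite eqxx.
    have := fq _ Ii _ _ _ def_q an.
    by have [[-> _]|[-> _]] := joins_pair ja je; rewrite ?Tt ?Tv.
have [f [w [rest' def_rest]]] : exists f w rest', rest = (f, w) :: rest'.
  case: rest def_r {wr ur le_n} => [|[f w] rest'] def_r; last by exists f, w, rest'.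
  by move: Tr; rewrite def_r /away /target /= (negPf Tv).
rewrite {}def_rest in def_r.
have := wr; rewrite def_r /= => /and3P[_ jf wrest].
have := ur; rewrite def_r /= inE negb_or => /andP[/andP[ef erest] /andP[frest urest]].
have fe : f \in edges (r e) by rewrite def_r !inE eqxx orbT.
have Af : A f := b_sub B Ie fe.
have tr := no_return lA B Ie; rewrite def_r /= !inE !negb_or in tr.
have {tr} /and3P[vt wt trest] := tr.
pose g' := reattach g e t w; pose A' := delete A [:: f].
have wt' : w != t by rewrite eq_sym.
have [[t2 [Tt2 t2t [p [Y [i [h [Lp fp bY Ii [def_p th Yv]]]]]]]]|none] := pselect
    (exists t2, [/\ T t2, t2 != t & exists p Y i h,
     [/\ linking T g A t2 p, forall j, star g A t2 j -> inner_free T t2 (p j),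
    barrier T g A t2 p Y, star g A t2 i & [/\ p i = h ++ [:: (e, t)], target t2 h = v & Y v]]]).
  have tp : target t2 (p i) = t by rewrite def_p target_cat.
  have Bp := proj1 Lp.
  exists (rwalk t2 (p i)); split.
  - split; first by rewrite -{1}tp; apply: walk_rwalk; exact: (b_walk Bp Ii).
    by rewrite def_p rwalk_cat th /=; eexists; eexists.
  - split; first by rewrite edges_rwalk rev_uniq (b_uniq Bp Ii).
    by move=> c; rewrite edges_rwalk mem_rev; exact: (b_sub Bp Ii).
  - by rewrite -[X in target X _]tp target_rwalk /away Tt2.
  - by rewrite -{1}tp; apply: inner_free_rwalk; exact: fp.
  - move=> t3 Tt3.
    have := linkable_reroute lA Lp Tt2 bY Ii def_p th Yv Tt3 (lk' _ Tt3).
    apply: linkable_congr => // c.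
    by rewrite /delete edges_rwalk mem_rev.
have lkg t2 : T t2 -> t2 != t -> linkable T g' A' t2.
  move=> Tt2 t2t; have tt2 : t != t2 by rewrite eq_sym.
  have [//|H] := split_off gA lA Tt2 Tt Tv tt2 Ae Af ef je jf (lk' _ Tt2).
  by case: none; exists t2.
have gA' : parity T g' A' by exact: (parity_reattach gA Tt Ae Af ef je jf).
have lA' : loopless g' A'.
  move=> c x /andP[Ac _]; rewrite /joins /g' /reattach.
  case: (c == e); last exact: (lA c x Ac).
  by rewrite !xpair_eqE; apply/negP => /orP[]/andP[/eqP tx /eqP wx]; rewrite tx wx eqxx in wt.
have dom i : star g' A' t i -> star g A t i.
  case/andP => /andP[Ai _]; rewrite /star Ai /inc /g' /reattach /=.
  by have [->|//] := eqVneq i e; case/andP: Ie.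
have Ie' : star g' A' t e.
  by rewrite /star /A' /delete Ae inE ef /inc /g' /reattach eqxx /= eqxx.
pose r' := upd r e ((e, w) :: rest').
have g_off c : c != e -> g' c = g c by rewrite /g' /reattach => /negPf->.
have ne i : star g A t i -> i != e -> e \in edges (r i) -> False.
  by move=> Ii + ei; rewrite (b_disj B Ii Ie ei (bunch_self B Ie)) eqxx.
have nf i : star g A t i -> i != e -> f \in edges (r i) -> False.
  by move=> Ii + ei; rewrite (b_disj B Ii Ie ei fe) eqxx.
have restA c : c \in edges rest' -> c \in edges (r e).
  by move=> cr; rewrite def_r !inE cr !orbT.
have wrest' : walk g' w rest'.
  rewrite (@walk_congr _ _ g' g) // => c cr; apply: g_off.
  by apply: contraNneq erest => <-.
have jwe : joins g' e t w by rewrite /joins /g' /reattach !eqxx.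
have Br' : bunch g' A' (star g' A' t) t r'.
  have B1 : bunch g' A' (fun i => star g' A' t i && (i != e)) t r.
    apply: (bunch_weak B) => [i /andP[/dom]//|i c /andP[/dom Ii ie] ci].
    split; last first.
      by rewrite g_off //; apply/eqP => ce; rewrite ce in ci; exact: (ne _ Ii ie ci).
    rewrite /A' /delete (b_sub B Ii ci) inE; apply/eqP => cf; rewrite cf in ci.
    exact: (nf _ Ii ie ci).
  have S i : star g' A' t i -> i != e -> star g' A' t i && (i != e) by move=> -> ->.
  have own c : c \in edges ((e, w) :: rest') -> c \in edges (r e).
    by rewrite inE => /orP[/eqP->|/restA//]; rewrite def_r inE eqxx.
  split; rewrite /r'.
  - move=> i Ii; have [->|ie] := eqVneq i e; first by rewrite upd_same /= jwe.
    by rewrite upd_other // (b_walk B1 (S _ Ii ie)).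
  - move=> i Ii; have [->|ie] := eqVneq i e; first by rewrite upd_same; exists w, rest'.
    by rewrite upd_other //; exact: (b_head B1 (S _ Ii ie)).
  - move=> i c Ii; have [->|ie] := eqVneq i e; last first.
      by rewrite upd_other //; exact: (b_sub B1 (S _ Ii ie)).
    rewrite upd_same => cr; rewrite /A' /delete (b_sub B Ie (own _ cr)) inE.
    move: cr; rewrite inE => /orP[/eqP->//|cr].
    by apply: contraNneq frest => <-.
  - move=> i Ii; have [->|ie] := eqVneq i e; first by rewrite upd_same /= erest.
    by rewrite upd_other // (b_uniq B1 (S _ Ii ie)).
  - have sub i c : c \in edges (upd r e ((e, w) :: rest') i) -> c \in edges (r i).
      by rewrite /upd; case: eqP => [->|//]; exact: own.
    move=> i j c /dom Ii /dom Ij /sub ci /sub cj.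
    exact: (b_disj B Ii Ij ci cj).
have Lr' : linking T g' A' t r'.
  split=> // i /dom Ii; rewrite /r'; have [->|ie] := eqVneq i e.
    by rewrite upd_same; move: Tr; rewrite def_r.
  by rewrite upd_other // tB.
have fr' i : star g' A' t i -> inner_free T t (r' i).
  move=> /dom Ii; rewrite /r'; have [->|ie] := eqVneq i e; last by rewrite upd_other //; exact: fr.
  rewrite upd_same => -[//|d s1] a s2 [<- def_rest] _.
  have /= := fr _ Ie [:: (e, v), (f, w) & s1] a s2; rewrite def_r def_rest.
  by move=> /(_ erefl isT).
have sz : size (r' e) <= n by move: le_n; rewrite /r' upd_same def_r.
have [s [[ws [y [s' def_s]]] [us sA] Ts fs lks]] := IH _ _ _ gA' lA' Tt lkg Lr' fr' Ie' sz.
have yw : y = w.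
  by move: ws; rewrite def_s /= => /andP[jy _]; exact: joins_inj jy jwe.
rewrite {}yw in def_s.
move: us; rewrite def_s /= => /andP[es' us'].
have fs' : f \notin edges s'.
  apply/negP => fs'; have := sA f.
  by rewrite def_s inE fs' orbT /A' /delete inE eqxx andbF => /(_ isT).
exists [:: (e, v), (f, w) & s']; split.
- split; last by exists v, ((f, w) :: s').
  rewrite /= je jf /=; move: ws; rewrite def_s /= => /andP[_].
  rewrite (@walk_congr _ _ g' g) // => c cr; apply: g_off.
  by apply: contraNneq es' => <-.
- split; first by rewrite /= inE negb_or ef es' fs' us'.
  move=> c; rewrite !inE => /or3P[/eqP->//|/eqP->//|cs].
  by have /andP[] : A' c by apply: sA; rewrite def_s inE cs orbT.
- by move: Ts; rewrite def_s.
- move=> [//|d [|d' s1]] a s2 [<-]; first by move=> _ _ _; rewrite /target /=.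
  move=> <- def_s' _; have := fs ((e, w) :: s1) a s2.
  by rewrite def_s def_s' => /(_ erefl isT).
- move=> t2 /lks; apply: linkable_congr => c.
    rewrite /A' /delete def_s !inE !negb_or.
    by case: (c == e); case: (c == f); rewrite ?andbF ?andbT.
  case/andP => _; rewrite def_s inE negb_or => /andP[ce _]; exact: g_off.
Qed.

End Peel.

(** * Finite separators, bundles of walks, and codes *)

Local Open Scope classical_set_scope.

Lemma well_ordering (W : eqType) : exists R : rel W,
  [/\ total R, antisymmetric R, transitive R
    & forall P : W -> Prop, (exists x, P x) ->
        exists z, P z /\ forall x, P x -> R z x].
Proof.
have [R wR] := well_ordering_principle W; exists R.
have least (P : W -> Prop) : (exists x, P x) -> exists z, P z /\ forall x, P x -> R z x.
  move=> [x Px]; have [|z [[zP zmin] _]] := wR [pred x | `[< P x >]].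
    by exists x; apply/asboolP.
  exists z; split; first exact: (asboolW zP).
  by move=> y Py; apply: zmin; apply/asboolP.
have chR : @wo_chain W R [pred _ | true] by move=> A _; exact: wR.
have tR : total R by move=> x y; exact: (wo_chainW chR).
have aR : antisymmetric R by move=> x y; exact: (wo_chain_antisymmetric chR).
split=> // y x z xy yz.
have [|m [mxyz mmin]] := least (fun a => [\/ a = x, a = y | a = z]).
  by exists x; constructor 1.
have [mx my mz] : [/\ R m x, R m y & R m z].
  by split; apply: mmin; [constructor 1|constructor 2|constructor 3].
case: mxyz => mE; rewrite {}mE in mx my mz => //.
  by have <- : y = x by apply: aR; rewrite mx xy.
by have -> : z = y by apply: aR; rewrite my yz.
Qed.

Lemma countable_enum (U : Type) (P : set U) : countable P ->
  exists c : nat -> option U, (forall n x, c n = Some x -> P x) /\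
    (forall x, P x -> exists n, c n = Some x).
Proof.
case/countable_injP => f fi.
have /choice[c cP] : forall n, exists o : option U,
    (forall x, o = Some x -> P x /\ f x = n) /\ (forall x, P x -> f x = n -> o = Some x).
  move=> n; have [[x [Px fx]]|no] := pselect (exists x, P x /\ f x = n).
    exists (Some x); split=> [y [<-]//|y Py fy]; congr Some; apply: fi.
    - exact: mem_set.
    - exact: mem_set.
    - by rewrite fx fy.
  by exists None; split=> // x Px fx; case: no; exists x.
exists c; split=> [n x /(proj1 (cP n))[]//|x Px].
by exists (f x); apply: (proj2 (cP _)).
Qed.

Lemma countable_mem (U : eqType) (l : seq U) : countable [set x | x \in l].
Proof. by apply: finite_set_countable; exact: finite_seq. Qed.

Lemma countable_subset (U : Type) (P Q : set U) : P `<=` Q -> countable Q -> countable P.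
Proof. by move=> /subset_card_le; exact: sub_countable. Qed.

Section Bundles.
Variables V E : choiceType.
Implicit Types (g : E -> V * V) (x y z v : V) (e f h : E).
Implicit Types (s : seq (E * V)) (X : pred V) (A D M R : pred E).

Lemma reach_cross g A x y X : reach g A x y -> X x != X y ->
  exists2 e, A e & crosses g X e.
Proof.
case=> s [ws As <-] Xxy; have := odd_crossings X ws.
have -> : X x (+) X (target x s) by move: Xxy; case: (X x); case: (X _).
case: (boolP (has (crosses g X) (edges s))) => [/hasP[e /As Ae ce] _|]; first by exists e.
by rewrite has_count -leqNgt leqn0 => /eqP->.
Qed.

Definition support (b : nat -> seq (E * V)) : set E := [set e | exists n, e \in edges (b n)].

Lemma countable_support b : countable (support b).
Proof.
apply: (@countable_subset _ _ (\bigcup_n [set e | e \in edges (b n)])).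
  by move=> e [n en]; exists n.
by apply: bigcup_countable => // n _; exact: countable_mem.
Qed.

Definition bundle g D x y : set (nat -> seq (E * V)) := [set b |
  (forall n, [/\ walk g x (b n), target x (b n) = y & {in edges (b n), forall e, D e}]) /\
  (forall m n e, e \in edges (b m) -> e \in edges (b n) -> m = n)].

(** If no finite set of edges separates [x] from [y], walks can be chosen greedily,
each avoiding the edges of the previous ones. *)
Lemma bundle_exists g D x y : (forall l : seq E, reach g (delete D l) x y) ->
  exists b, bundle g D x y b.
Proof.
move=> /choice[w wP].
pose L n := iter n (fun l => edges (w l) ++ l) [::].
have Lmono m n : m <= n -> {subset L m <= L n}.
  move/subnK <-; elim: (n - m) => [//|d IH] e /IH eL.
  by rewrite addSn /= mem_cat eL orbT.
have lt m n e : m < n -> e \in edges (w (L m)) -> e \notin edges (w (L n)).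
  move=> mn em; apply/negP => en; have [_ H _] := wP (L n).
  have /andP[_] := H _ en; rewrite (Lmono m.+1 n mn) //= mem_cat em //.
exists (fun n => w (L n)); split.
  by move=> n; have [ww sw tw] := wP (L n); split=> // e /sw/andP[].
move=> m n e em en; case: (ltngtP m n) => // mn.
  by move: (lt _ _ _ mn em); rewrite en.
by move: (lt _ _ _ mn en); rewrite em.
Qed.

Lemma bundle_reach g D R x y b (l : seq E) : bundle g D x y b ->
  (forall e, support b e -> R e) -> reach g (delete R l) x y.
Proof.
move=> [bP bd] bR; apply: contrapT => nr.
have /choice[c cP] : forall n, exists e, e \in edges (b n) /\ e \in l.
  move=> n; apply: contrapT => no; apply: nr; exists (b n); have [wb tb _] := bP n.
  split=> // e en; rewrite /delete bR; last by exists n.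
  by apply/negP => el; apply: no; exists e.
have uc : uniq (map c (iota 0 (size l).+1)).
  rewrite map_inj_uniq ?iota_uniq // => m n cmn.
  by apply: (bd _ _ (c m)); [have [] := cP m | rewrite cmn; have [] := cP n].
have sc : {subset map c (iota 0 (size l).+1) <= l}.
  by move=> e /mapP[n _ ->]; have [] := cP n.
by have := uniq_leq_size uc sc; rewrite size_map size_iota ltnn.
Qed.

(** Choose a maximal family of edge-disjoint bundles between [x] and [y].  By maximality
and [bundle_exists], outside of these bundles a finite set [L] separates [x] from
[y].  Let [N] relate the edges of the same bundle.  If [M] contains [L] and is a union
of classes of [N] otherwise, then a walk from [x] to [y] outside [M] must meet some
bundle, which then lies outside [M] as a whole and cannot be blocked by finitely many
edges.  Because of this grouping into infinite bundles no cardinalities need to be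
compared. *)
Lemma bundle_cover g D x y : exists (L : seq E) (N : E -> E -> Prop),
  [/\ {in L, forall e, D e}, forall h, countable [set e | N h e],
      forall h e, N h e -> D e
    & forall M M' : pred E, (forall e, M e -> M' e) -> (forall e, M' e -> D e) ->
      {in L, forall e, M e} -> (forall h e, M h -> N h e -> M e) ->
      (forall h e, M' h -> N h e -> M' e) ->
      reach g (fun e => M' e && ~~ M e) x y ->
      forall l, reach g (delete (fun e => M' e && ~~ M e) l) x y].
Proof.
have [<-|xy] := eqVneq x y.
  exists [::], (fun _ _ => False); split=> //.
  by move=> *; exact: reach_refl.
have [B [BD Bd Bmax]] := ex_maximal_disjoint_subcollection support (bundle g D x y).
pose R e := D e && `[< ~ exists2 b, B b & support b e >].
have [L nL] : exists L : seq E, ~ reach g (delete R L) x y.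
  apply: contrapT => H.
  have [l|b bR] := @bundle_exists g R x y.
    by apply: contrapT => nr; apply: H; exists l.
  have bD : bundle g D x y b.
    case: bR => bP bd; split=> // n; have [wb tb Rb] := bP n; split=> // e /Rb/andP[] //.
  have nb b' : B b' -> forall e, support b e -> support b' e -> False.
    move=> Bb' e [n en] eb'; case: bR => bP _; have [_ _ Rb] := bP n.
    by have /andP[_ /asboolP H'] := Rb _ en; apply: H'; exists b'.
  have [e eb] : exists e, support b e.
    case: bR => bP _; have [wb tb _] := bP 0; case def_b: (b 0) tb => [|[e v] s] tb.
      by move: xy; rewrite -tb eqxx.
    by exists e, 0; rewrite def_b inE eqxx.
  apply: (Bmax (B `|` [set b])).
  - split; first by move=> ?; left.
    by move=> /(_ b (or_intror erefl)) /nb/(_ e eb).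
  - by move=> b' [/BD//|->].
  - move=> b1 b2 [B1|->] [B2|->] // [f [f1 f2]]; first by apply: Bd => //; exists f.
      by case: (nb _ B1 f f2 f1).
    by case: (nb _ B2 f f1 f2).
exists (filter D L), (fun h e => exists2 b, B b & support b h /\ support b e); split.
- by move=> e; rewrite mem_filter => /andP[].
- move=> h; have [[b Bb bh]|no] := pselect (exists2 b, B b & support b h).
    apply: (@countable_subset _ _ (support b)) (countable_support b).
    move=> e [b' Bb' [b'h b'e]].
    by have <- : b' = b by apply: Bd => //; exists h.
  apply: (@countable_subset _ _ set0) => // e [b Bb [bh _]].
  by apply: no; exists b.
- by move=> h e [b /BD[bP _] [_ [n en]]]; have [_ _ bD] := bP n; exact: bD.
move=> M M' MM' M'D LM NM NM' [s [ws Fs ts]] l.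
have [h hs nh] : exists2 h, h \in edges s & ~~ delete R L h.
  apply: contrapT => no; apply: nL; exists s; split=> // h hs.
  by apply: contraT => nh; case: no; exists h.
have /andP[M'h nMh] := Fs _ hs.
have hL : h \notin L.
  by apply: contra nMh => hL; apply: LM; rewrite mem_filter hL M'D.
have [b Bb bh] : exists2 b, B b & support b h.
  apply: contrapT => no; move: nh; rewrite /delete hL andbT /R M'D //=.
  by move=> /asboolP; apply.
apply: (bundle_reach l (BD _ Bb)) => e be; apply/andP; split.
  by apply: NM' M'h _; exists b.
by apply: contra nMh => Me; apply: NM Me _; exists b.
Qed.

End Bundles.

(** Names for the members of a generated set.  Numerals serve to name operations and,
by [encode] and [decode], to absorb one generator: a set generated by the elements
up to [a] is also generated by those strictly below [a]. *)
Inductive code (W : Type) := Atom of W | Numeral of nat | Join of code W & code W.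
Arguments Numeral {W}.

Section Codes.
Variable W : choiceType.
Implicit Types (P Q : pred W) (c : code W).

Fixpoint leaves P c := match c with
  | Atom a => P a | Numeral _ => true | Join c1 c2 => leaves P c1 && leaves P c2 end.

Lemma leaves_sub P Q c : (forall a, P a -> Q a) -> leaves P c -> leaves Q c.
Proof.
by move=> PQ; elim: c => //= c1 IH1 c2 IH2 /andP[/IH1-> /IH2->].
Qed.

Fixpoint tree_of c : GenTree.tree nat := match c with
  | Atom _ => GenTree.Node 1 [::] | Numeral n => GenTree.Leaf n
  | Join c1 c2 => GenTree.Node 0 [:: tree_of c1; tree_of c2] end.

Lemma tree_of_inj c1 c2 : leaves xpred0 c1 -> leaves xpred0 c2 ->
  tree_of c1 = tree_of c2 -> c1 = c2.
Proof.
elim: c1 c2 => [//|n|a1 IH1 a2 IH2] [//|m|b1 b2] //= => [_ _ [->]//|].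
by move=> /andP[l1 l2] /andP[m1 m2] [/(IH1 _ l1 m1)-> /(IH2 _ l2 m2)->].
Qed.

Lemma countable_leafless : countable [set c : code W | leaves xpred0 c].
Proof.
apply/countable_injP; exists (choice.pickle \o tree_of) => c1 c2.
move=> /set_mem l1 /set_mem l2 /=.
by move/(pcan_inj (@choice.pickleK (GenTree.tree nat))); exact: tree_of_inj.
Qed.

Fixpoint encode a c := match c with
  | Atom b => if b == a then Numeral 0 else Atom b
  | Numeral n => Numeral n.+1
  | Join c1 c2 => Join (encode a c1) (encode a c2) end.
Fixpoint decode a c := match c with
  | Atom b => Atom b
  | Numeral n => if n is m.+1 then Numeral m else Atom a
  | Join c1 c2 => Join (decode a c1) (decode a c2) end.

Lemma encodeK a : cancel (encode a) (decode a).
Proof. by elim=> //= [b|c1 -> c2 ->//]; case: eqP => [->|]. Qed.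

Lemma leaves_encode P a c : leaves (fun b => P b || (b == a)) c -> leaves P (encode a c).
Proof.
elim: c => //= [b|c1 IH1 c2 IH2]; last by case/andP=> /IH1-> /IH2->.
by case: eqP => //= _; rewrite orbF.
Qed.

End Codes.

(** * Partition into countable classes without odd cuts *)

Section Partition.
Variables V E : choiceType.
Variables (g : E -> V * V) (N : E -> E -> Prop).
Hypothesis symN : forall e f, N e f -> N f e.
Hypothesis countN : forall e, countable [set f | N e f].
Implicit Types (x y z v : V) (e f h a b : E) (l : seq E).
Implicit Types (s : seq (E * V)) (X : pred V) (A D M R P : pred E).

Definition even_cuts D := forall X, ~ oddset (fun e => D e && crosses g X e).
Definition nclosed D := forall e f, D e -> N e f -> D f.
Definition within M D := forall e, M e -> D e.
Definition diff M' M : pred E := fun e => M' e && ~~ M e.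
Definition closed_under (O : seq E -> set E) M :=
  forall l e, {in l, forall f, M f} -> O l e -> M e.

Lemma inc_cross e X : crosses g X e -> exists x y, [/\ joins g e x y, X x & ~~ X y].
Proof.
rewrite /crosses; case C1: (X _); case C2: (X _) => // _.
  by exists (g e).1, (g e).2; rewrite joins_refl C1 C2.
by exists (g e).2, (g e).1; rewrite joinsC joins_refl C1 C2.
Qed.

(** The set [O l] contains, for the ends [x] and [y] of the first two edges of [l] and the
list [F] of the others, the edges of a walk from [x] to [y] avoiding [F], the finite
set and the bundles of [bundle_cover], and the relatives of the edges in [F].

If [M] is closed and [X] cuts it in a finite set [l], then no walk outside [l] joins two
vertices of [M] on different sides of [X]; otherwise one would lie inside [M].  So
the vertices reachable outside [l] from the side of [X] in [M] form a set with the
same cut [l] in the whole of [D].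

If [M] is a closed subset of [M'] and [X] cuts the difference in a finite set, then each
component of the difference has all its vertices of [M] on the same side of [X], by
the choice of the bundles.  Exchanging sides in the components where this is the side
of [X] gives a set with the same cut that avoids all vertices of [M]; therefore this is
its cut in [M'] as well. *)
Lemma closure_system D : even_cuts D -> nclosed D -> exists O : seq E -> set E,
  [/\ forall l, countable (O l), closed_under O D,
      forall M, within M D -> closed_under O M -> even_cuts M /\ nclosed M
    & forall M M', within M M' -> within M' D -> closed_under O M ->
        closed_under O M' -> even_cuts (diff M' M)].
Proof.
move=> eD nD.
have /choice[w wP] : forall d : V * V * seq E, exists l,
    {in l, forall e, D e} /\ (reach g (delete D d.2) d.1.1 d.1.2 ->
       exists s, [/\ walk g d.1.1 s, {in edges s, forall e, delete D d.2 e},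
          target d.1.1 s = d.1.2 & edges s = l]).
  case=> [[x y] F]; have [[s [ws Fs ts]]|no] := pselect (reach g (delete D F) x y).
    by exists (edges s); split=> [e /Fs/andP[]//|_]; exists s.
  by exists [::]; split=> //.
have /choice[L0 L0P] := fun d : V * V => bundle_cover g D d.1 d.2.
have /choice[B0 B0P] := L0P; clear L0P.
pose Op x y (F : seq E) : set E := [set e | e \in w (x, y, F)] `|`
  [set e | e \in L0 (x, y)] `|`
  \bigcup_(h in [set h | h \in F]) ([set e | B0 (x, y) h e] `|` [set f | N h f]).
pose O l : set E := if l is e1 :: e2 :: F then
  [set e | exists x y, [/\ inc g x e1, inc g y e2 & Op x y F e]] else set0.
have cOp x y F : countable (Op x y F).
  rewrite /Op -bigcup2E.
  apply: bigcup_countable => // i _; rewrite /bigcup2; case: i => [|[|i]] //=.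
    rewrite -bigcup2E; apply: bigcup_countable => // j _; rewrite /bigcup2.
    by case: j => [|[|j]] //=; exact: countable_mem.
  apply: bigcup_countable => [|h _]; first exact: countable_mem.
  rewrite -bigcup2E; apply: bigcup_countable => // j _; rewrite /bigcup2.
  by case: j => [|[|j]] //=; case: (B0P (x, y)).
have OpD x y F e : {in F, forall f, D f} -> Op x y F e -> D e.
  move=> FD [[/(proj1 (wP (x, y, F)))//|]|[h hF [|]]].
  - by case: (B0P (x, y)) => LD _ _ _ /LD.
  - by case: (B0P (x, y)) => _ _ BD _ /BD.
  - by apply: nD; exact: FD.
pose ends e := [set x | x \in [:: (g e).1; (g e).2]].
have endsP x e : inc g x e -> ends e x.
  by rewrite /ends /= !inE /inc => /orP[]/eqP->; rewrite eqxx ?orbT.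
exists O.
have clw M x y F : within M D -> closed_under O M -> (exists2 e, M e & inc g x e) ->
    (exists2 e, M e & inc g y e) -> {in F, forall f, M f} ->
    reach g (delete D F) x y -> reach g (delete M F) x y.
  move=> MD cM [e1 M1 x1] [e2 M2 y2] FM /(proj2 (wP (x, y, F)))[s [ws Ds ts es]].
  exists s; split=> // e ei; have /andP[_ eF] := Ds _ ei; rewrite /delete eF andbT.
  apply: (cM [:: e1, e2 & F]).
    by move=> f; rewrite !inE => /or3P[/eqP->|/eqP->|/FM].
  by exists x, y; split=> //; left; left; rewrite /= -es.
have eM M : within M D -> closed_under O M -> even_cuts M.
  move=> MD cM X [l [ul Xl ol]].
  have lM e : e \in l -> M e /\ crosses g X e by rewrite -Xl => /andP[].
  pose X' z := `[< exists x, [/\ X x, exists2 e, M e & inc g x e & reach g (delete D l) x z] >].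
  apply: (eD X'); exists l; split=> // e; apply/idP/idP.
    case/andP => De /inc_cross[x [y [je /asboolP[z [Xz Mz rz]] nX]]].
    apply: contraNT nX => el; apply/asboolP; exists z; split=> //.
    by apply: reach_step rz _ je; rewrite /delete De.
  move=> el; have [Me /inc_cross[x [y [je Xx Xy]]]] := lM _ el.
  rewrite MD //= (joins_cross _ je).
  have -> : X' x.
    apply/asboolP; exists x; split=> //; last exact: reach_refl.
    by exists e; rewrite // (joins_inc _ je) eqxx.
  apply/negP => /asboolP[z [Xz Mz rz]].
  have My : exists2 e, M e & inc g y e by exists e; rewrite // (joins_inc _ je) eqxx orbT.
  have rM := clw _ _ _ _ MD cM Mz My (fun f fl => proj1 (lM f fl)) rz.
  have [|f /andP[Mf fl] cf] := reach_cross rM (X := X); first by rewrite Xz.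
  by move: fl; rewrite -Xl Mf cf.
split=> //.
- case=> [|e1 [|e2 F]] //=.
  apply: (@countable_subset _ _ (\bigcup_(x in ends e1) \bigcup_(y in ends e2) Op x y F)).
    by move=> e [x [y [/endsP x1 /endsP y2 oe]]]; exists x => //; exists y.
  apply: bigcup_countable => [|x _]; first exact: countable_mem.
  apply: bigcup_countable => [|y _]; first exact: countable_mem.
  exact: cOp.
- case=> [|e1 [|e2 F]] //= e lD [x [y [_ _ oe]]]; apply: OpD oe => f fF.
  by apply: lD; rewrite !inE fF !orbT.
- move=> M MD cM; split; first exact: eM.
  move=> e f Me Nef; apply: (cM [:: e; e; e]).
    by move=> h; rewrite !inE => /or3P[]/eqP->.
  have ie : inc g (g e).1 e by rewrite /inc eqxx.
  exists (g e).1, (g e).1; split=> //; right; exists e; last by right.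
  by rewrite /= inE.
move=> M M' MM' M'D cM cM' X [l [ul Xl ol]].
have MD : within M D by move=> e /MM'/M'D.
pose R := diff M' M.
pose touch x := exists2 e, M e & inc g x e.
have inf x y : touch x -> touch y -> reach g R x y -> reach g (delete R l) x y.
  move=> [e1 M1 x1] [e2 M2 y2] r; case: (B0P (x, y)) => _ _ _ /=; apply=> //.
  - move=> e eL; apply: (cM [:: e1; e2]).
      by move=> h; rewrite !inE => /orP[]/eqP->.
    by exists x, y; split=> //; left; right.
  - move=> h e Mh Bhe; apply: (cM [:: e1; e2; h]).
      by move=> f; rewrite !inE => /or3P[]/eqP->.
    exists x, y; split=> //; right; exists h; last by left.
    by rewrite /= inE.
  - move=> h e Mh Bhe; apply: (cM' [:: e1; e2; h]).
      by move=> f; rewrite !inE => /or3P[]/eqP-> //; apply: MM'.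
    exists x, y; split=> //; right; exists h; last by left.
    by rewrite /= inE.
(* [flip z]: the component of [z] has its vertices of [M] on the side of [X]. *)
pose flip z := `[< exists x, [/\ X x, touch x & reach g R z x] >].
have flipR e : R e -> forall x y, joins g e x y -> flip x -> flip y.
  move=> Re x y je /asboolP[z [Xz tz rz]]; apply/asboolP; exists z; split=> //.
  apply: reach_trans rz; apply: (reach_step (reach_refl _ _ _) Re).
  by rewrite joinsC.
have flipX z : touch z -> flip z = X z.
  move=> tz; apply/idP/idP => [/asboolP[x [Xx tx rx]]|Xz]; last first.
    by apply/asboolP; exists z; split=> //; exact: reach_refl.
  apply: contraT => nXz; have [|f /andP[Rf fl] cf] := reach_cross (inf _ _ tz tx rx) (X := X).
    by rewrite Xx (negPf nXz).
  by move: fl; rewrite -Xl [diff _ _ _]Rf cf.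
pose Y z := X z (+) flip z.
apply: (eM _ M'D cM' Y); exists l; split=> // e; rewrite -Xl /diff.
case M'e: (M' e) => //=; have je := joins_refl g e; case Me: (M e) => /=.
  have t1 : touch (g e).1 by exists e; rewrite // /inc eqxx.
  have t2 : touch (g e).2 by exists e; rewrite // /inc eqxx orbT.
  by rewrite /crosses /Y !flipX // !addbb.
have Re : R e by rewrite /R /diff M'e Me.
rewrite /crosses /Y; have -> : flip (g e).1 = flip (g e).2.
  by apply/idP/idP; apply: (flipR _ Re) => //; rewrite joinsC.
by case: (X _); case: (X _); case: (flip _).
Qed.

Definition even_partition D := exists K : E -> pred E,
  [/\ forall e, D e -> K e e, forall e f, D e -> K e f -> D f /\ K f = K e
    & forall e, D e -> [/\ countable [set f | K e f], even_cuts (K e) & nclosed (K e)]].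

Definition spanned D P := exists f : code E -> option E,
  forall e, D e -> exists c, leaves P c /\ f c = Some e.

Section Generation.
Variables (D : pred E) (O : seq E -> set E).
Hypothesis countO : forall l, countable (O l).
Hypothesis OD : closed_under O D.

(** Evaluation of codes as lists of edges: numerals in front select the given spanning
map or the n-th value of the operations, other pairs concatenate.  The members
of the subset generated by the generators in [Q] are those named by singleton
values. *)
Lemma generate P : spanned D P -> exists val : code E -> seq E,
  [/\ forall c, {in val c, forall e, D e},
      forall e, D e -> exists c, leaves P c /\ val c = [:: e]
    & forall Q, closed_under O (fun e => `[< exists c, leaves Q c /\ val c = [:: e] >])].
Proof.
case=> f fP.
have /choice[op opP] := fun l => countable_enum (countO l).
pose item (o : option E) : seq E := if o is Some e then if D e then [:: e] else [::] else [::].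
pose fix val (c : code E) : seq E := if c is Join c1 c2 then
  match c1 with
  | Numeral 0 => item (f c2)
  | Numeral n.+1 => item (op (val c2) n)
  | _ => val c1 ++ val c2
  end else [::].
have itemD o : {in item o, forall e, D e}.
  by case: o => //= h; case: ifP => // Dh e; rewrite inE => /eqP->.
exists val; split.
- elim=> //= c1 IH1 c2 IH2; case: c1 IH1 => [b|[|n]|a1 a2] IH1 //.
  by move=> e; rewrite mem_cat => /orP[/IH1|/IH2].
- move=> e De; have [c [Pc fc]] := fP _ De; exists (Join (Numeral 0) c); split=> //=.
  by rewrite fc /= De.
move=> Q l e lQ Oe; apply/asboolP.
have lD : {in l, forall e, D e}.
  move=> h /lQ/asboolP[c [_ vc]]; have : h \in val c by rewrite vc inE.
  elim: c {vc} => //= c1 IH1 c2 IH2; case: c1 IH1 => [b|[|n]|a1 a2] IH1 //; try exact: itemD.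
  by rewrite mem_cat => /orP[/IH1|/IH2].
have [c [Qc vc]] : exists c, leaves Q c /\ val c = l.
  elim: l lQ {lD Oe} => [|h l IH] lQ; first by exists (Numeral 0).
  have [|c [Qc vc]] := IH; first by move=> f' fl; apply: lQ; rewrite inE fl orbT.
  have /asboolP[c' [Qc' vc']] := lQ h (mem_head _ _).
  exists (Join c' c); split; first by rewrite /= Qc' Qc.
  by case: c' vc' {Qc'} => //= c1 c2 ->; rewrite vc.
have [n opn] := proj2 (opP l) _ Oe.
exists (Join (Numeral n.+1) c); split=> //=.
by rewrite vc opn /= (OD lD Oe).
Qed.

End Generation.

(** Let M(Q) be the closed subset generated by the generators in [Q], and M(0) the one
generated without any.  An edge outside M(0) belongs to exactly one difference of M(b : b <= a) and M(b : b < a).  Each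
difference has no odd cuts by [closure_system] and is spanned by the generators
strictly below [a], so it can be partitioned by hypothesis.  M(0) itself is
countable. *)
Lemma even_partition_spanned (W : rel E) D P : total W -> antisymmetric W ->
  transitive W ->
  (forall Q : E -> Prop, (exists a, Q a) -> exists b, Q b /\ forall a, Q a -> W b a) ->
  (forall a b, P a -> W b a -> P b) ->
  (forall a, P a -> forall D', even_cuts D' -> nclosed D' ->
     spanned D' (fun b => W b a && (b != a)) -> even_partition D') ->
  even_cuts D -> nclosed D -> spanned D P -> even_partition D.
Proof.
move=> tW aW trW minW downP IH eD nD sD.
have refW a : W a a by have := tW a a; rewrite orbb.
have [O [cO OD clM clMM]] := closure_system eD nD.
have [val [valD valP cval]] := generate cO OD sD.
pose M Q : pred E := fun e => `[< exists c, leaves Q c /\ val c = [:: e] >].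
have MD Q : within (M Q) D.
  by move=> e /asboolP[c [_ vc]]; apply: (valD c); rewrite vc inE.
have Mmono (Q Q' : pred E) : (forall a, Q a -> Q' a) -> within (M Q) (M Q').
  move=> QQ' e /asboolP[c [lc vc]]; apply/asboolP; exists c; split=> //.
  exact: leaves_sub lc.
have cM Q : closed_under O (M Q) by exact: cval.
pose le a : pred E := fun b => W b a.
pose lt a : pred E := fun b => W b a && (b != a).
have lt_le a : within (M (lt a)) (M (le a)) by apply: Mmono => b /andP[].
pose piece a := diff (M (le a)) (M (lt a)).
have split_leaves (Q : pred E) (c : code E) : leaves Q c -> leaves xpred0 c \/
    exists a, Q a /\ leaves (le a) c.
  elim: c => [a Qa|n _|c1 IH1 c2 IH2] /=; last 1 first.
  - case/andP => /IH1[l1|[a1 [Q1 l1]]] /IH2[l2|[a2 [Q2 l2]]].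
    + by left; rewrite l1.
    + by right; exists a2; split=> //; rewrite l2 (leaves_sub _ l1).
    + by right; exists a1; split=> //; rewrite l1 (leaves_sub _ l2).
    + have [a12|a21] := orP (tW a1 a2); right.
        exists a2; split=> //; rewrite l2 andbT; apply: leaves_sub l1 => b.
        by move=> /trW; apply.
      exists a1; split=> //; rewrite l1 /=; apply: leaves_sub l2 => b.
      by move=> /trW; apply.
  - by right; exists a; rewrite /le /= refW.
  - by left.
pose M0 := M xpred0.
have M0lt a : within M0 (M (lt a)) by exact: Mmono.
have locate e : D e -> M0 e \/ exists a, P a /\ piece a e.
  move=> De; have [|nM0] := boolP (M0 e); [by left|right].
  have [c [Pc vc]] := valP _ De.
  have [l0|[b [Pb lb]]] := split_leaves _ _ Pc.
    by case/negP: nM0; apply/asboolP; exists c.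
  have [|a [Ma amin]] := minW (fun a => M (le a) e).
    by exists b; apply/asboolP; exists c.
  exists a; split.
    by apply: downP Pb _; apply: amin; apply/asboolP; exists c.
  rewrite /piece /diff Ma; apply/negP => /asboolP[c' [lc' vc']].
  have [l0|[d [/andP[da nda] ld]]] := split_leaves _ _ lc'.
    by case/negP: nM0; apply/asboolP; exists c'.
  case/negP: nda; apply/eqP/aW; rewrite da; apply: amin; apply/asboolP.
  by exists c'.
(* If [a] is below [b], the piece of [a] is generated strictly below [b]. *)
have piece_inj a b e : piece a e -> piece b e -> a = b.
  move=> /andP[ea na] /andP[eb nb]; apply: contrapT => /eqP ab.
  have [Wab|Wba] := orP (tW a b).
    case/negP: nb; apply: Mmono ea => c ca; rewrite /lt (trW _ _ _ ca Wab).
    by apply: contra ab => /eqP cb; apply/eqP/aW; rewrite Wab -cb.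
  case/negP: na; apply: Mmono eb => c cb; rewrite /lt (trW _ _ _ cb Wba).
  by apply: contra ab => /eqP ca; apply/eqP/aW; rewrite Wba -ca andbT.
have pieceD a e : piece a e -> D e by case/andP => /MD.
have M0piece a e : M0 e -> piece a e -> False.
  by move=> /M0lt Me /andP[_]; rewrite Me.
have nM Q : nclosed (M Q) by case: (clM (M Q) (@MD Q) (@cM Q)).
have npiece a : nclosed (piece a).
  move=> e f /andP[ea na] ef; rewrite /piece /diff (nM _ _ _ ea ef).
  by apply: contra na => fa; exact: (nM _ _ _ fa (symN ef)).
have spiece a : spanned (piece a) (lt a).
  exists (fun c => ohead (val (decode a c))) => e /andP[/asboolP[c [lc vc]] _].
  exists (encode a c); split; last by rewrite encodeK vc.
  apply: leaves_encode; apply: leaves_sub lc => b ba; rewrite /lt.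
  by case: eqP => [_|_]; rewrite ?orbT // orbF andbT.
have /choice[K KP] : forall a, exists K : E -> pred E, P a ->
    [/\ forall e, piece a e -> K e e,
        forall e f, piece a e -> K e f -> piece a f /\ K f = K e
      & forall e, piece a e ->
          [/\ countable [set f | K e f], even_cuts (K e) & nclosed (K e)]].
  move=> a; have [Pa|] := boolP (P a); last by exists (fun _ _ => true).
  have [|K H] := IH a Pa (piece a) _ (npiece a) (spiece a); last by exists K.
  exact: clMM (@lt_le a) (@MD _) (@cM _) (@cM _).
have /choice[a aP] : forall e, exists a, D e -> ~~ M0 e -> P a /\ piece a e.
  move=> e; have [De|] := boolP (D e); last by exists e.
  by have [Me|[a Ha]] := locate _ De; [exists e; rewrite Me|exists a].
exists (fun e => if M0 e then M0 else K (a e) e); split.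
- move=> e De; case: ifPn => // nM0; have [Pa pa] := aP _ De nM0.
  by case: (KP _ Pa) => H _ _; exact: H.
- move=> e f De; case: ifPn => [Me Mf|nM0]; first by rewrite Mf; split=> //; exact: MD Mf.
  have [Pa pa] := aP _ De nM0; case: (KP _ Pa) => _ H _ /(H _ _ pa)[pf Kf].
  have Df := pieceD _ _ pf; split=> //.
  have nMf : ~~ M0 f by apply/negP => /M0piece/(_ pf).
  rewrite (negPf nMf); have [_ pf'] := aP _ Df nMf.
  by rewrite (piece_inj _ _ _ pf' pf).
- move=> e De; case: ifPn => [Me|nM0]; last first.
    have [Pa pa] := aP _ De nM0; case: (KP _ Pa) => _ _; exact.
  have [eM0 nM0] := clM M0 (@MD _) (@cM _); split=> //.
  apply: (@countable_subset _ _ (\bigcup_(c in [set c : code E | leaves xpred0 c])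
      [set f | f \in val c])).
    by move=> f /asboolP[c [lc vc]]; exists c; rewrite //= vc inE.
  by apply: bigcup_countable => [|c _]; [exact: countable_leafless|exact: countable_mem].
Qed.

Lemma even_partition_exists D : even_cuts D -> nclosed D -> even_partition D.
Proof.
move=> eD nD; have [W [tW aW trW minW]] := well_ordering E.
have step a : forall D', even_cuts D' -> nclosed D' ->
    spanned D' (fun b => W b a && (b != a)) -> even_partition D'.
  apply: contrapT => na; have [|m [nm mmin]] := minW (fun a => ~ forall D',
      even_cuts D' -> nclosed D' -> spanned D' (fun b => W b a && (b != a)) ->
      even_partition D'); first by exists a.
  apply: nm => D' eD' nD'; apply: (even_partition_spanned tW aW trW minW) => //.
    move=> b c /andP[bm nbm] cb; rewrite (trW _ _ _ cb bm) /=.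
    by apply: contra nbm => /eqP cm; apply/eqP/aW; rewrite bm -cm.
  move=> b /andP[bm nbm]; apply: contrapT => nb.
  by case/negP: nbm; apply/eqP/aW; rewrite bm mmin.
apply: (@even_partition_spanned W D predT tW aW trW minW _ (fun a _ => step a) eD nD) => //.
by exists (fun c => if c is Atom e then Some e else None) => e _; exists (Atom e).
Qed.

End Partition.

(** * Covering all edges at the terminals of a countable graph *)

Section Packing.
Variables V E : choiceType.
Variables (T : pred V) (g : E -> V * V).
Implicit Types (x y z t v : V) (e f : E) (s : seq (E * V)) (A B : pred E).

Lemma last_T x s1 c z s2 : inner_free T x (s1 ++ (c, z) :: s2) -> T z -> s2 = [::].
Proof.
case: s2 => // d s2 fr Tz; have := fr (rcons s1 (c, z)) d s2.
by rewrite cat_rcons target_rcons Tz -size_eq0 size_rcons => /(_ erefl isT).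
Qed.

(** Cutting out cycles preserves the edges at terminals, which are the first and the last
one. *)
Lemma simplify x s : walk g x s -> T x -> away T x (target x s) -> inner_free T x s ->
  exists s', [/\ walk g x s', target x s' = target x s, uniq (x :: unzip2 s'),
    {subset edges s' <= edges s} & inner_free T x s' /\
    forall e t, e \in edges s -> T t -> inc g t e -> e \in edges s'].
Proof.
move=> ws Tx /andP[Ty yx] fr; have [s' [ws' ts' us' ss']] := shorten_walk ws.
have lastd c z : (c, z) \in s -> T z -> z = target x s /\ exists u, s = rcons u (c, z).
  move=> /splitPr cs Tz; case: cs fr => u1 u2 fr; have u20 := last_T fr Tz.
  by rewrite u20 cats1 target_rcons; split=> //; exists u1.
exists s'; split=> //; first exact: edges_sub.
split.
  move=> s1 a s2 def_s' s1n; apply/negP => Ts1.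
  case/lastP: s1 s1n def_s' Ts1 => // s1 [c z] _ def_s'; rewrite target_rcons => Tz.
  have [|zt _] := lastd c z _ Tz.
    by apply: ss'; rewrite def_s' mem_cat mem_rcons inE eqxx.
  move: us'; rewrite def_s' cat_rcons /unzip2 map_cat /= cat_uniq => /and4P[_ _ _ /andP[nz _]].
  case/negP: nz; rewrite zt -ts' def_s' cat_rcons target_cat /target /=.
  exact: mem_last.
move=> e t es Tt te; have [u1 [z [u2 def_s]]] := mem_split es.
have := ws; rewrite def_s walk_cat /= => /and3P[_ je _].
have s'n : s' != [::].
  by apply: contra_neq yx => s'0; rewrite -ts' s'0.
move: te; rewrite (joins_inc _ je) => /orP[/eqP te|/eqP te].
  have u10 : u1 = [::].
    apply/eqP; apply: contraT => u1n; have := fr _ _ _ def_s u1n.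
    by rewrite -te Tt.
  case: s' ws' ss' {ts' us'} s'n => // -[e' z'] s' /= /andP[je' _] ss' _.
  have /splitPr de : (e', z') \in s by apply: ss'; rewrite inE eqxx.
  case: de def_s fr ws {es lastd ss' yx Ty} => w1 w2 def_s fr.
  rewrite walk_cat /= => /and3P[_ je'' _].
  have w1x : target x w1 = x by apply: (@joins_inj _ _ g e' z'); rewrite joinsC.
  have w10 : w1 = [::].
    apply/eqP; apply: contraT => w1n; have := fr _ _ _ erefl w1n.
    by rewrite w1x Tx.
  by move: def_s; rewrite w10 u10 => -[-> _ _]; rewrite inE eqxx.
have u20 : u2 = [::] by apply: (@last_T x u1 e z); rewrite -?def_s // -te.
case/lastP: s' ws' ss' us' ts' s'n => // s' [e' z'] _ ss' _; rewrite target_rcons => z't _.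
have Tz' : T z' by rewrite z't.
have ez' : (e', z') \in s by apply: ss'; rewrite mem_rcons inE eqxx.
have [_ [u def_su]] := lastd e' z' ez' Tz'.
move: def_su; rewrite def_s u20 cats1 => /rcons_inj[_ -> _].
by rewrite /edges /unzip1 map_rcons mem_rcons inE eqxx.
Qed.

Definition trail_of A (p : V * seq (E * V)) := [/\ T p.1, walk g p.1 p.2,
  {in edges p.2, forall e, A e}, away T p.1 (target p.1 p.2) & inner_free T p.1 p.2].

Definition packing A (P : set (V * seq (E * V))) := [/\
  forall p, P p -> trail_of A p,
  forall p q e, P p -> P q -> e \in edges p.2 -> e \in edges q.2 -> p = q
  & forall e t, A e -> T t -> inc g t e -> exists2 p, P p & e \in edges p.2].

Definition feasible A := [/\ parity T g A, loopless g A &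
  forall t, T t -> linkable T g A t].

Lemma extend_packing A e : feasible A -> exists B o,
  feasible B /\ ((o = None /\ B = A /\ forall t, A e -> T t -> ~~ inc g t e) \/
    exists p, [/\ o = Some p, trail_of A p, B = delete A (edges p.2) & e \in edges p.2]).
Proof.
move=> [gA lA kA]; have [[t [Ae Tt te]]|no] := pselect (exists t, [/\ A e, T t & inc g t e]).
  have [r [Lr fr]] := tame_linking lA (kA _ Tt).
  have Ie : star g A t e by rewrite /star Ae.
  have [|s [[ws [y [s' def_s]]] [us sA] Ts fs lks]] :=
      @peel_path _ _ T (size (r e)) g A t e r gA lA Tt _ Lr fr Ie (leqnn _).
    by move=> t2 Tt2 _; exact: kA.
  exists (delete A (edges s)), (Some (t, s)); split.
    split=> //; last by move=> c x /andP[Ac _]; exact: lA.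
    by apply: (parity_delete gA ws) => //; case/andP: Ts.
  by right; exists (t, s); split=> //=; rewrite def_s inE eqxx.
exists A, None; split=> //; left; split=> //; split=> // t Ae Tt.
by apply/negP => te; apply: no; exists t.
Qed.

Lemma countable_packing A : feasible A -> countable [set e | A e] ->
  exists P, packing A P.
Proof.
move=> fA /countable_enum[c [_ cA]].
have /choice[nxt nxtP] : forall d : pred E * option E,
    exists r : pred E * option (V * seq (E * V)), feasible d.1 ->
    feasible r.1 /\ ((r.2 = None /\ r.1 = d.1 /\
        forall e t, d.2 = Some e -> d.1 e -> T t -> ~~ inc g t e) \/
      exists p, [/\ r.2 = Some p, trail_of d.1 p, r.1 = delete d.1 (edges p.2)
        & forall e, d.2 = Some e -> e \in edges p.2]).
  case=> B [e|]; last by exists (B, None) => fB; split=> //; left.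
  have [fB|nB] := pselect (feasible B); last by exists (B, None).
  have [B' [o [fB' H]]] := extend_packing e fB; exists (B', o) => _; split=> //=.
  case: H => [[-> [-> H]]|[p [-> tp -> ep]]].
    by left; split=> //; split=> // e' t [<-]; exact: H.
  by right; exists p; split=> // e' [<-].
pose B := fix B n := if n is m.+1 then (nxt (B m, c m)).1 else A.
pose out n := (nxt (B n, c n)).2.
have fB n : feasible (B n).
  by elim: n => //= n /(nxtP (B n, c n))[].
have step n : (out n = None /\ B n.+1 = B n /\
        forall e t, c n = Some e -> B n e -> T t -> ~~ inc g t e) \/
      exists p, [/\ out n = Some p, trail_of (B n) p, B n.+1 = delete (B n) (edges p.2)
        & forall e, c n = Some e -> e \in edges p.2].
  by have [_ H] := nxtP (B n, c n) (fB n).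
have Bdown m n e : m <= n -> B n e -> B m e.
  move/subnK <-; elim: (n - m) => [//|d IH].
  by rewrite addSn; case: (step (d + m)) => [[_ [-> _]]//|[p [_ _ -> _]] /andP[/IH]].
have outP n p : out n = Some p -> trail_of (B n) p /\ B n.+1 = delete (B n) (edges p.2).
  by case: (step n) => [[-> _]//|[q [-> tq Bq _]] [<-]].
exists [set p | exists n, out n = Some p]; split.
- move=> p [n /outP[[Tp wp pB tp fp] _]]; split=> // e /pB; exact: (Bdown 0).
- have lt m n p q e : m < n -> out m = Some p -> out n = Some q ->
      e \in edges p.2 -> e \notin edges q.2.
    move=> mn /outP[_ Bm] /outP[[_ _ qB _ _] _] ep; apply/negP => /qB.
    by move/(Bdown _ _ _ mn); rewrite Bm /delete ep andbF.
  move=> p q e [m om] [n on] ep eq; case: (ltngtP m n) => mn.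
  + by move: (lt _ _ _ _ e mn om on ep); rewrite eq.
  + by move: (lt _ _ _ _ e mn on om eq); rewrite ep.
  + by move: om; rewrite mn on => -[].
- move=> e t Ae Tt te; have [n cn] := cA _ Ae.
  have H m : B m e \/ exists2 p, (exists n, out n = Some p) & e \in edges p.2.
    elim: m => [|m [Bm|]]; [by left| |by right].
    case: (step m) => [[_ [-> _]]|[p [om _ -> _]]]; first by left.
    have [ep|ep] := boolP (e \in edges p.2); last by left; rewrite /delete Bm.
    by right; exists p => //; exists m.
  have [Bn|//] := H n.
  case: (step n) => [[_ [_ nt]]|[p [on _ _ ep]]]; last first.
    by exists p; [exists n|exact: ep].
  by move: (nt _ _ cn Bn Tt); rewrite te.
Qed.

End Packing.

(** * The theorem *)

Lemma In_mem (U : eqType) (x : U) (l : seq U) : List.In x l <-> x \in l.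
Proof.
elim: l => //= a l ->; rewrite inE eq_sym.
by split=> [[->|->]|/orP[/eqP->|]]; rewrite ?eqxx ?orbT //; [left|right].
Qed.

Lemma uniq_NoDup (U : eqType) (l : seq U) : uniq l -> List.NoDup l.
Proof.
elim: l => [|a l IH] /=; first by constructor.
by case/andP => al /IH; constructor => // /In_mem; apply/negP.
Qed.

Lemma NoDup_uniq (U : eqType) (l : seq U) : List.NoDup l -> uniq l.
Proof.
by elim=> //= a l' al _ ->; rewrite andbT; apply/negP => /In_mem.
Qed.

Lemma oddset_card (U : choiceType) (S : pred U) : oddset S ->
  exists2 n, odd n & ([set e | S e] #= `I_n)%card.
Proof.
case=> l [ul Sl ol]; exists (size l) => //.
have -> : [set e | S e] = [set` [fset x in l]%fset].
  by apply/seteqP; split=> e; rewrite /= !inE Sl.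
by apply/card_eq_fsetP; rewrite card_fseq undup_id.
Qed.

Section Translation.
Variable G : multigraph.
Let V : choiceType := {classic (vertex G)}.
Let E : choiceType := {classic (edge G)}.
Variable g : E -> V * V.
Hypothesis gE : forall e : E, (g e).1 <> (g e).2 /\ ends e = [set (g e).1; (g e).2].

Lemma ends_inc (e : E) (v : V) : ends e v <-> inc g v e.
Proof.
have [_ ->] := gE e; rewrite /inc; split=> [[->|->]|/orP[]/eqP<-].
- by rewrite eqxx.
- by rewrite eqxx orbT.
- by left.
- by right.
Qed.

Lemma joins_ends (e : E) (x y : V) : joins g e x y -> ends e = [set x; y].
Proof. by have [_ ->] := gE e; move=> /orP[]/eqP-> //=; rewrite setUC. Qed.

Lemma ends_joins (e : E) (x y : V) : ends e = [set x; y] -> joins g e x y.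
Proof.
have [ne def_e] := gE e; rewrite def_e => eq_xy.
have in_xy z : [set (g e).1; (g e).2] z -> z = x \/ z = y by rewrite eq_xy; case=> ->; [left|right].
have := in_xy _ (or_introl erefl); have := in_xy _ (or_intror erefl).
rewrite /joins; case: (g e) ne {eq_xy in_xy def_e} => a b /= ne bxy axy.
by case: axy bxy ne => -> [] -> // _; rewrite eqxx ?orbT.
Qed.

Lemma steps_walk (x : V) (s : seq (E * V)) : steps_from (x : vertex G) s <-> walk g x s.
Proof.
elim: s x => [|[e y] s IH] x //=; rewrite IH; split.
  by case=> /ends_joins-> ->.
by case/andP => /joins_ends.
Qed.

Lemma delta_crosses (X : pred V) (e : E) : delta [set v : vertex G | X v] e <-> crosses g X e.
Proof.
have [ne def_e] := gE e; rewrite /delta /= def_e /crosses; split.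
  move=> [x [[xe Xx] xu]]; case X1: (X (g e).1); case X2: (X (g e).2) => //.
    case: ne; transitivity x.
      by symmetry; apply: xu; split=> //; left.
    by apply: xu; split=> //; right.
  by case: xe Xx => ->; rewrite /= ?X1 ?X2.
case X1: (X (g e).1); case X2: (X (g e).2) => // _.
  exists (g e).1; split; first by split; [left|].
  by move=> y [[->|->]] //=; rewrite X2.
exists (g e).2; split; first by split; [right|].
by move=> y [[->|->]] //=; rewrite X1.
Qed.

Lemma first_edge (t : V) (s : seq (E * V)) (i : E) : walk g t s ->
  uniq (t :: unzip2 s) -> i \in edges s -> inc g t i -> exists y s', s = (i, y) :: s'.
Proof.
case: s => [|[e y] s] //= /andP[je ws] /andP[ts us].
rewrite inE => /orP[/eqP-> _|is_ ti]; first by exists y, s.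
by have := walk_ends ws is_ ti; move: ts => /= /negPf->.
Qed.

(** A T-path that contains an edge at [t] starts or ends at [t], so that it can be
oriented away from [t]. *)
Lemma T_path_walk (T : set (vertex G)) (t : V) (i : E) (p : vewalk G) :
  is_T_path T p -> T t -> path_edges p i -> inc g t i ->
  exists s : seq (E * V), [/\ walk g t s, uniq (t :: unzip2 s), T (target t s),
    target t s != t & forall c : E, c \in edges s <-> path_edges p c].
Proof.
case: p => x s0 [[/= st nd] Tx Ty xy int] Tt ie ti.
pose s : seq (E * V) := s0.
have ws : walk g x s by apply/steps_walk.
have us : uniq ((x : V) :: unzip2 s) by apply: NoDup_uniq.
have es (c : E) : c \in edges s <-> path_edges (x, s0) c by rewrite -In_mem.
have ts : t \in (x : V) :: unzip2 s by apply: (walk_ends ws _ ti); apply/es.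
have [tx|tx] := eqVneq t (x : V).
  rewrite tx; exists s; split=> //.
  by apply/eqP => yx; apply: xy; rewrite /first_vertex /last_vertex /=; exact: esym yx.
have ty : t = target (x : V) s.
  apply: contrapT => ty; suff : set0 (t : vertex G) by [].
  rewrite -int; split=> //; split; [|exact: (elimN eqP tx)|exact: ty].
  exact: (proj2 (@In_mem V t (x :: unzip2 s)) ts).
exists (rwalk (x : V) s); split.
- by rewrite ty; exact: walk_rwalk.
- rewrite unzip2_rwalk ty; have := us.
  by rewrite -rev_uniq lastI rev_rcons.
- by rewrite ty target_rwalk.
- by rewrite {1}ty target_rwalk eq_sym.
- by move=> c; rewrite edges_rwalk mem_rev.
Qed.

Lemma walk_T_path (T : set (vertex G)) (x : V) (s : seq (E * V)) :
  walk g x s -> T x -> T (target x s) -> target x s != x ->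
  uniq (x :: unzip2 s) -> inner_free (fun v : V => `[< T v >]) x s ->
  is_T_path T (x, s).
Proof.
move=> ws Tx Ty yx us fr; split=> //.
- split; first exact/steps_walk.
  exact: (@uniq_NoDup V).
- by move=> xy; move/eqP: yx; apply.
apply/seteqP; split=> // v [[vs vx vy] Tv].
have /vertex_split[s1 [s2 [def_s tv]]] : (v : V) \in x :: unzip2 s.
  by apply/(@In_mem V).
case: s2 def_s => [|a s2] def_s.
  by apply: vy; rewrite -tv /last_vertex /= def_s cats0.
have s1n : s1 != [::] by apply/eqP => s10; apply: vx; rewrite -tv s10.
by have /asboolP := fr _ _ _ def_s s1n; rewrite tv.
Qed.

End Translation.

Theorem theorem1p4 (G : multigraph) (T : set (vertex G)) :
  countable T ->
  ~ (exists2 X : set (vertex G), X `<=` ~` T & odd_degree X) ->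
  (forall t, T t ->
     exists2 P : set (vewalk G), T_path_system T P & covers P (edges_at t)) ->
  exists2 P : set (vewalk G),
    T_path_system T P & covers P (\bigcup_(t in T) edges_at t).
Proof.
move=> cT noodd linkT.
have [[t0 Tt0]|noT] := pselect (exists t, T t); last first.
  exists set0; first by split.
  by move=> e [t Tt]; case: noT; exists t.
pose V : choiceType := {classic (vertex G)}; pose E : choiceType := {classic (edge G)}.
have /choice[g gE] : forall e : E, exists uv : V * V,
    uv.1 <> uv.2 /\ ends e = [set uv.1; uv.2].
  by move=> e; have [u [v [uv de]]] := endsP e; exists (u, v).
pose Tb : pred V := fun v => `[< T v >].
have TbP v : T v -> Tb v by move=> ?; apply/asboolP.
have lg (A : pred E) : loopless g A.
  by move=> e x _; rewrite /joins orbb; apply/eqP => ge; have [] := gE e; rewrite ge.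
(* Identifying all terminals turns the parity condition into the absence of odd
   finite cuts. *)
pose pi (v : V) : V := if Tb v then t0 else v.
pose gc (e : E) := (pi (g e).1, pi (g e).2).
have cross_gc X e : crosses gc X e = crosses g (X \o pi) e by [].
have ev : even_cuts gc predT.
  move=> X oX; apply: noodd.
  have [Y [YT YX]] : exists Y : pred V, (forall v, Tb v -> ~~ Y v) /\
      forall e, crosses g Y e = crosses gc X e.
    case X0: (X t0).
      exists (predC (X \o pi)); split=> [v Tv|e].
        by rewrite /= /pi Tv X0.
      by rewrite /crosses /=; case: (X _); case: (X _).
    by exists (X \o pi); split=> // v Tv; rewrite /= /pi Tv X0.
  exists [set v : vertex G | Y v].
    by move=> v Yv /TbP/YT; rewrite Yv.
  have [n on En] := oddset_card oX; exists n => //.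
  rewrite (_ : delta _ = [set e : E | predT e && crosses gc X e]) //.
  apply/seteqP; split=> e /=.
    by move/(delta_crosses gE); rewrite YX.
  by move=> H; apply/(delta_crosses gE); rewrite YX.
have /choice[P PP] : forall t : V, exists P : set (vewalk G),
    T t -> T_path_system T P /\ covers P (edges_at t).
  move=> t; have [Tt|nT] := pselect (T t); last by exists set0.
  by have [P sP cP] := linkT t Tt; exists P.
pose N (e f : E) := exists t : V, T t /\ exists p, [/\ P t p, path_edges p e & path_edges p f].
have symN e f : N e f -> N f e.
  by move=> [t [Tt [p [Pp pe pf]]]]; exists t; split=> //; exists p.
have countN e : countable [set f | N e f].
  apply: (@countable_subset _ _ (\bigcup_(t in T) [set f | exists p,
      [/\ P t p, path_edges p e & path_edges p f]])).
    by move=> f [t [Tt Ht]]; exists t.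
  apply: bigcup_countable => // t Tt.
  have [[p0 [Pp0 p0e]]|no] := pselect (exists p, P t p /\ path_edges p e); last first.
    by apply: (@countable_subset _ _ set0) => // f [p [Pp pe _]]; apply: no; exists p.
  apply: (@countable_subset _ _ [set f : E | f \in edges (p0.2 : seq (E * V))]).
    move=> f [p [Pp pe pf]]; apply/(@In_mem E).
    suff <- : p = p0 by [].
    by have [[_ tI] _] := PP t Tt; apply: tI => //; exists e.
  exact: countable_mem.
have [K [K1 K2 K3]] := even_partition_exists symN countN ev (fun e f _ _ => isT).
have feas e : feasible Tb g (K e).
  have [cK eK nK] := K3 e isT; split=> //.
    move=> X XT oX; apply: (eK X); case: oX => l [ul Kl ol]; exists l; split=> // f.
    rewrite -Kl cross_gc /crosses /= /pi; have XF v : Tb v -> X v = X t0.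
      move=> Tv; have nX w : Tb w -> X w = false.
        by move=> Tw; apply/negP => /XT; rewrite Tw.
      by rewrite !nX //; exact: TbP.
    by do 2![case: ifP => [/XF->|_]].
  move=> t /asboolP Tt; have [[sP tI] cP] := PP t Tt.
  have /choice[W WP] : forall i : E, exists s : seq (E * V), star g (K e) t i ->
      exists p, [/\ P t p, path_edges p i &
        [/\ walk g t s, uniq (t :: unzip2 s), T (target t s),
    target t s != t & forall c : E, c \in edges s <-> path_edges p c]].
    move=> i; have [/andP[Ki ti]|] := boolP (star g (K e) t i); last by exists [::].
    have [p Pp pi_] := cP i (proj2 (ends_inc gE i t) ti).
    by have [s Hs] := T_path_walk gE (sP _ Pp) Tt pi_ ti; exists s => _; exists p.
  have inW i p : path_edges p i -> (forall c : E, c \in edges (W i) <-> path_edges p c) ->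
    i \in edges (W i) by move=> pi_ H; apply/H.
  exists W; split; first split.
  - by move=> i /WP[p [_ _ []]].
  - move=> i Ii; have [p [_ pi_ [ww uw _ _ ew]]] := WP i Ii.
    by apply: (first_edge ww uw (proj2 (ew i) pi_)); case/andP: Ii.
  - move=> i c Ii; have [p [Pp pi_ [_ _ _ _ ew]]] := WP i Ii.
    move/ew => pc; case/andP: Ii => Ki _; apply: (nK _ _ Ki).
    by exists t; split=> //; exists p.
  - by move=> i /WP[p [_ _ [ww uw _ _ _]]]; exact: walk_uniq_edges ww uw.
  - move=> i j c Ii Ij; have [p [Pp pi_ [ww uw _ _ ew]]] := WP i Ii.
    have [q [Pq qj [_ _ _ _ ew']]] := WP j Ij => /ew pc /ew' qc.
    have pq : p = q by apply: tI => //; exists c.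
    have /andP[_ ti] := Ii; have /andP[_ tj] := Ij.
    have [y [s' def1]] := first_edge ww uw (proj2 (ew i) pi_) ti.
    have ji : j \in edges (W i) by apply/ew; rewrite pq.
    have [y' [s'' def2]] := first_edge ww uw ji tj.
    by move: def1; rewrite def2 => -[].
  - move=> i /WP[p [_ _ [_ _ Ty yt _]]]; rewrite /away yt andbT; exact: TbP.
have /choice[pk pkP] : forall A : pred E, exists S : set (V * seq (E * V)),
    (exists e, A = K e) -> packing Tb g A S.
  move=> A; have [[e ->]|no] := pselect (exists e, A = K e); last by exists set0.
  have [cK _ _] := K3 e isT.
  by have [S HS] := countable_packing (feas e) cK; exists S.
have pkK e : packing Tb g (K e) (pk (K e)) by apply: pkP; exists e.
have /choice[sm smP] : forall p : V * seq (E * V), exists s' : seq (E * V),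
    (exists e, pk (K e) p) ->
    [/\ walk g p.1 s', target p.1 s' = target p.1 p.2, uniq (p.1 :: unzip2 s'),
    {subset edges s' <= edges p.2} & inner_free Tb p.1 s' /\
    forall e t, e \in edges p.2 -> Tb t -> inc g t e -> e \in edges s'].
  move=> p; have [[e Pe]|no] := pselect (exists e, pk (K e) p); last by exists [::].
  have [H _ _] := pkK e; have [Tp wp _ tp fp] := H _ Pe.
  by have [s' Hs'] := simplify wp Tp tp fp; exists s'.
exists [set q : vewalk G | exists p, (exists e, pk (K e) p) /\ q = (p.1, sm p)].
  split.
    move=> q [p [[e Pe] ->]]; have [ws ts us ss [fs _]] := smP p (ex_intro _ e Pe).
    have [H _ _] := pkK e; have [/asboolP Tp _ _ /andP[/asboolP Ty yx] _] := H _ Pe.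
    by apply: (walk_T_path gE) => //; rewrite ts.
  move=> q q' [p [[e Pe] ->]] [p' [[e' Pe'] ->]] [f [/(@In_mem E) pf /(@In_mem E) p'f]].
  have [_ _ _ ss _] := smP p (ex_intro _ e Pe).
  have [_ _ _ ss' _] := smP p' (ex_intro _ e' Pe').
  have {}pf := ss _ pf; have {}p'f := ss' _ p'f.
  have [H D _] := pkK e; have [H' _ _] := pkK e'.
  have [_ _ Kf _ _] := H _ Pe; have [_ _ K'f _ _] := H' _ Pe'.
  have [_ Kef] := K2 e f isT (Kf _ pf); have [_ Ke'f] := K2 e' f isT (K'f _ p'f).
  suff -> : p = p' by [].
  by apply: (D _ _ f Pe _ pf p'f); rewrite -Kef Ke'f.
move=> e [t Tt et].
have [_ _ C] := pkK e; have te := proj1 (ends_inc gE e t) et.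
have [p Pp ep] := C e t (K1 e isT) (TbP _ Tt) te.
have [_ _ _ _ [_ cov]] := smP p (ex_intro _ e Pp).
exists (p.1, sm p); first by exists p; split=> //; exists e.
by apply/(@In_mem E); exact: cov ep (TbP _ Tt) te.
Qed.
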